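(* Let $f$, $g$, $T$ satisfy the standing assumptions in the context, let $\mu>0$, let $\mathbf{prox}_{\mu g}$ be semismooth, let $f$ be strongly convex with parameter $m_f>0$, and assume that the differential inclusion $$\dot w \in -\left(\partial_C^2\mathcal{L}_\mu(w)\right)^{-1}\nabla\mathcal{L}_\mu(w)$$ has a solution (for every initial condition $w(0)$). Then this differential inclusion is globally exponentially stable: there exists $\kappa>0$ such that every solution satisfies $$\|w(t)-w^\star\|\le \kappa\, e^{-t}\,\|w(0)-w^\star\|\quad\text{for all } t\ge 0,$$ where $w^\star=(x^\star,y^\star)$ is the optimal primal-dual pair.
   Context: Problem: minimize $f(x)+g(Tx)$ over $x\in\mathbb{R}^n$, equivalently minimize $f(x)+g(z)$ subject to $Tx-z=0$. Standing assumptions: $f:\mathbb{R}^n\to\mathbb{R}$ is twice continuously differentiable, has $L_f$-Lipschitz continuous gradient, and is strictly convex with $\nabla^2 f(x)\succ0$ for all $x$; $g:\mathbb{R}^m\to\mathbb{R}\cup\{+\infty\}$ is proper, closed and convex; $T\in\mathbb{R}^{m\times n}$ has full row rank. The optimal primal-dual pair $w^\star=(x^\star,y^\star)$ is characterized by $\nabla f(x^\star)+T^Ty^\star=0$, $y^\star\in\partial g(Tx^\star)$. Proximal operator: $\mathbf{prox}_{\mu g}(v)=\operatorname{argmin}_z\,(g(z)+\frac1{2\mu}\|z-v\|^2)$. Moreau envelope: $M_{\mu g}(v)=\min_z\,(g(z)+\frac1{2\mu}\|z-v\|^2)$, with $\nabla M_{\mu g}(v)=\frac1\mu(v-\mathbf{prox}_{\mu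 g}(v))$. Proximal augmented Lagrangian, with $w=(x,y)\in\mathbb{R}^n\times\mathbb{R}^m$: $$\mathcal{L}_\mu(w)=\mathcal{L}_\mu(x;y)=f(x)+M_{\mu g}(Tx+\mu y)-\tfrac\mu2\|y\|^2,$$ whose gradient is $\nabla\mathcal{L}_\mu(w)=\big(\nabla f(x)+T^T\nabla M_{\mu g}(Tx+\mu y),\ \mu\nabla M_{\mu g}(Tx+\mu y)-\mu y\big)$. For locally Lipschitz $h:\mathbb{R}^m\to\mathbb{R}$, the $B$-subdifferential $\partial_Bh(\bar z)$ is the set of limits of $\nabla h(z_k)$ over sequences $z_k\to\bar z$ of points at which $h$ is differentiable; the Clarke subdifferential is $\partial_Ch(\bar z)=\mathrm{conv}\,\partial_Bh(\bar z)$. For $G:\mathbb{R}^m\to\mathbb{R}^p$, $\partial_CG(\bar z)$ is the set of matrices whose $i$-th row is (the transpose of) a member of $\partial_CG_i(\bar z)$. $G$ is semismooth if for every $\bar z$, every sequence $z_k\to\bar z$ and every $J_k\in\partial_CG(z_k)$, $\|G(z_k)-G(\bar z)+J_k(\bar z-z_k)\|=o(\|z_k-\bar z\|)$. Generalized Hessian: with $H=\nabla^2f(x)$ and $\mathbb{P}_C=\partial_C\,\mathbf{prox}_{\mu g}(Tx+\mu y)$, $$\partial_C^2\mathcal{L}_\mu(w)=\left\{\begin{bmatrix}H+\frac1\mu T^T(I-P)T & T^T(I-P)\\ (I-P)T&-\mu P\end{bmatrix}:\ P\in\mathbb{P}_C\right\}.$$ As throughout the paper, the matrices $P$ are symmetric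 with $0\preceq P\preceq I$ (only such $P\in\mathbb{P}_C$ are considered). $(\partial_C^2\mathcal{L}_\mu(w))^{-1}\nabla\mathcal{L}_\mu(w)$ denotes the set of all $J^{-1}\nabla\mathcal{L}_\mu(w)$ with $J\in\partial_C^2\mathcal{L}_\mu(w)$. A solution is an absolutely continuous $w:[0,\infty)\to\mathbb{R}^{n+m}$ satisfying the inclusion for almost every $t$. *)

(* Defs.v *)
(* R^n is the type ['cV[R]_n] of column vectors.  Its topology is that of the
   library (the one of the sup norm), but every norm occurring in a formula is
   the Euclidean norm [enorm] below. *)
From mathcomp Require Import all_boot all_order all_algebra.
From mathcomp Require Import all_classical all_reals all_analysis.
Import Order.TTheory GRing.Theory Num.Theory.
Import numFieldNormedType.Exports.

Set Implicit Arguments.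
Unset Strict Implicit.
Unset Printing Implicit Defensive.

Local Open Scope classical_set_scope.
Local Open Scope ring_scope.

Section Euclidean.
Context {R : realType}.

Definition dot n (u v : 'cV[R]_n) : R := \sum_i u i 0 * v i 0.

Definition enorm n (v : 'cV[R]_n) : R := Num.sqrt (dot v v).

Definition posdef n (A : 'M[R]_n) : Prop :=
  A^T = A /\ forall v : 'cV[R]_n, v != 0 -> 0 < dot v (A *m v).

Definition possemidef n (A : 'M[R]_n) : Prop :=
  A^T = A /\ forall v : 'cV[R]_n, 0 <= dot v (A *m v).

Definition grad n (h : 'cV[R]_n -> R) (x : 'cV[R]_n) : 'cV[R]_n :=
  \col_i 'D_(delta_mx i 0) h x.

Definition hess n (h : 'cV[R]_n -> R) (x : 'cV[R]_n) : 'M[R]_n :=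
  \matrix_(i, j) 'D_(delta_mx j 0) (fun y => grad h y i 0) x.

Definition twice_continuously_differentiable n (h : 'cV[R]_n -> R) : Prop :=
  [/\ forall x, differentiable h x,
      forall x, differentiable (grad h) x
    & continuous (hess h)].

Definition lipschitz_gradient n (L : R) (h : 'cV[R]_n -> R) : Prop :=
  forall x y, enorm (grad h x - grad h y) <= L * enorm (x - y).

Definition strictly_convex n (h : 'cV[R]_n -> R) : Prop :=
  forall (x y : 'cV[R]_n) (t : R), x != y -> 0 < t < 1 ->
    h (t *: x + (1 - t) *: y) < t * h x + (1 - t) * h y.

Definition strongly_convex n (c : R) (h : 'cV[R]_n -> R) : Prop :=
  @convex_function R 'cV[R]_n setT (fun x => h x - c / 2 * enorm x ^+ 2).

End Euclidean.

Section ExtendedValued.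
Context {R : realType} {m : nat}.
Implicit Types (g : 'cV[R]_m -> \bar R) (z v s : 'cV[R]_m) (mu : R).

(* The first clause says that g takes its values in R \cup {+oo}. *)
Definition proper_fun g : Prop :=
  (forall z, g z != -oo%E) /\ (exists z, g z != +oo%E).

Definition closed_fun g : Prop :=
  closed [set p : 'cV[R]_m * R | (g p.1 <= p.2%:E)%E].

Definition convex_fun g : Prop :=
  forall (x y : 'cV[R]_m) (t : R), 0 < t < 1 ->
    (g (t *: x + (1 - t) *: y)%R <= t%:E * g x + (1 - t)%:E * g y)%E.

Definition subdiff g z : set 'cV[R]_m :=
  [set s | forall z', (g z + (dot s (z' - z))%:E <= g z')%E].

Definition prox_obj mu g v z : \bar R :=
  (g z + ((2 * mu)^-1 * enorm (z - v) ^+ 2)%:E)%E.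

(* For mu > 0 and g proper, closed and convex the minimizer exists and is
   unique, so that [get] picks it. *)
Definition prox mu g v : 'cV[R]_m :=
  get [set z | forall z', (prox_obj mu g v z <= prox_obj mu g v z')%E].

Definition moreau mu g v : R := fine (ereal_inf (range (prox_obj mu g v))).

End ExtendedValued.

Section Nonsmooth.
Context {R : realType}.

Definition Bsubdiff m (h : 'cV[R]_m -> R) (zbar : 'cV[R]_m) : set 'cV[R]_m :=
  [set v | exists z : nat -> 'cV[R]_m,
    [/\ forall k, differentiable h (z k),
        z @ \oo --> zbar
      & (fun k => grad h (z k)) @ \oo --> v]].

Definition convex_hull m (A : set 'cV[R]_m) : set 'cV[R]_m :=
  smallest (@convex_set R 'cV[R]_m) A.

Definition clarke m (h : 'cV[R]_m -> R) (zbar : 'cV[R]_m) : set 'cV[R]_m :=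
  convex_hull (Bsubdiff h zbar).

Definition clarke_jacobian m p (G : 'cV[R]_m -> 'cV[R]_p) (zbar : 'cV[R]_m) :
    set 'M[R]_(p, m) :=
  [set J | forall i, clarke (fun z => G z i 0) zbar (row i J)^T].

Definition semismooth m p (G : 'cV[R]_m -> 'cV[R]_p) : Prop :=
  forall (zbar : 'cV[R]_m) (z : nat -> 'cV[R]_m) (J : nat -> 'M[R]_(p, m)),
    z @ \oo --> zbar -> (forall k, clarke_jacobian G (z k) (J k)) ->
    (fun k => enorm (G (z k) - G zbar + J k *m (zbar - z k)))
      =o_\oo (fun k => enorm (z k - zbar)).

End Nonsmooth.

Section PrimalDual.
Context {R : realType} {n m : nat}.
Variables (f : 'cV[R]_n -> R) (g : 'cV[R]_m -> \bar R) (T : 'M[R]_(m, n)).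
Variable mu : R.

(* A primal-dual point w = (x, y) is [col_mx x y]; conversely x and y are
   [usubmx w] and [dsubmx w]. *)

Definition optimal_pair (x : 'cV[R]_n) (y : 'cV[R]_m) : Prop :=
  grad f x + T^T *m y = 0 /\ subdiff g (T *m x) y.

Definition prox_arg (w : 'cV[R]_(n + m)) : 'cV[R]_m :=
  T *m usubmx w + mu *: dsubmx w.

Definition prox_aug_lagrangian (w : 'cV[R]_(n + m)) : R :=
  f (usubmx w) + moreau mu g (prox_arg w) - mu / 2 * enorm (dsubmx w) ^+ 2.

Definition newton_matrix (H : 'M[R]_n) (P : 'M[R]_m) : 'M[R]_(n + m) :=
  block_mx (H + mu^-1 *: (T^T *m (1%:M - P) *m T)) (T^T *m (1%:M - P))
           ((1%:M - P) *m T)                       (- (mu *: P)).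

Definition gen_hessian (w : 'cV[R]_(n + m)) : set 'M[R]_(n + m) :=
  [set newton_matrix (hess f (usubmx w)) P | P in
    [set P | [/\ clarke_jacobian (prox mu g) (prox_arg w) P,
                 possemidef P & possemidef (1%:M - P)]]].

(* Every J in [gen_hessian w] is invertible when hess f is positive definite,
   mu > 0 and T has full row rank, so [invmx J] is a genuine inverse. *)
Definition newton_field (w : 'cV[R]_(n + m)) : set 'cV[R]_(n + m) :=
  [set - (invmx J *m grad prox_aug_lagrangian w) | J in gen_hessian w].

End PrimalDual.

Section DifferentialInclusion.
Context {R : realType} {N : nat}.

Definition absolutely_continuous_on (a b : R) (w : R -> 'cV[R]_N) : Prop :=
  forall e : R, 0 < e -> exists2 d : R, 0 < d &
    forall (k : nat) (l r : 'I_k -> R),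
      (forall i, a <= l i <= r i /\ r i <= b) ->
      trivIset [set: 'I_k] (fun i => `]l i, r i[%classic) ->
      \sum_i (r i - l i) < d ->
      \sum_i enorm (w (r i) - w (l i)) < e.

(* A solution lives on [0, +oo[: absolute continuity is required on each
   compact [0, b], and the values of w at negative times are irrelevant. *)
Definition is_solution (F : 'cV[R]_N -> set 'cV[R]_N) (w : R -> 'cV[R]_N) :
    Prop :=
  (forall b, absolutely_continuous_on 0 b w) /\
  {ae @lebesgue_measure R,
    forall t : R, 0 <= t -> derivable w t 1 /\ F (w t) (derive1 w t)}.

End DifferentialInclusion.

(* Main.v *)
Require Import Defs.
From mathcomp Require Import all_boot all_order all_algebra.
From mathcomp Require Import all_classical all_reals all_analysis.
From mathcomp Require Import ring lra.
Import Order.TTheory GRing.Theory Num.Theory.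
Import numFieldNormedType.Exports.
Local Open Scope classical_set_scope.
Local Open Scope ring_scope.

(** Let F be the gradient of the proximal augmented Lagrangian.  It vanishes at
    the optimal pair, and the result follows from two facts about it.

    First, F is bi-Lipschitz on the whole space.  A difference F w - F w' has
    the form [saddle h p dx dy], where h and p are the increments of grad f and
    of the proximal operator.  Strong monotonicity of grad f and firm
    nonexpansiveness of the proximal operator bound dx by this quantity
    ([saddle_coercive]), and full row rank of T then bounds dy
    ([saddle_bounded_below]).  It is therefore enough that F (w t) decays like
    exp (- t).  The same computation, applied to increments that are linear in
    (dx, dy), shows that every generalized Hessian is invertible
    ([newton_matrix_unit]).

    Second, F (w t) = exp (- t) F (w 0) along every solution w.  Formally
    (F o w)' = J w' = - F o w, but F is only semismooth and the J selected by
    the inclusion at time t need not be the one that differentiates F o w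
    there.  The remedy is to read semismoothness at the moving point: if s
    decreases to t, then F (w s) - F (w t) is J_s (w s - w t) up to a small
    error, where J_s is the matrix selected at time s ([newton_approximation]).
    When moreover w' s tends to w' t, the difference quotient of F o w is close
    to J_s (w' s) = - F (w s), hence tends to - F (w t).  Such times s exist for
    all but countably many t, because a subset of the product of the line with
    a second countable space has only countably many points that are isolated
    from the right ([countable_not_right_limit]).  Finally, an absolutely
    continuous function is determined by its right difference quotients at
    almost every t, even when they are controlled only along one sequence
    decreasing to t ([ac_on_nonincreasing], [exponential_decay]). *)

Set Implicit Arguments.
Unset Strict Implicit.
Unset Printing Implicit Defensive.

(** * Euclidean spaces *)

Section EuclideanSpace.
Context {R : realType}.

Section Vectors.
Context {n : nat}.
Implicit Types (u v w : 'cV[R]_n) (a : R).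

Lemma dotC u v : dot u v = dot v u.
Proof. by apply: eq_bigr => i _; rewrite mulrC. Qed.

Lemma dotDl u v w : dot (u + v) w = dot u w + dot v w.
Proof. by rewrite /dot -big_split/=; apply: eq_bigr => i _; rewrite mxE mulrDl. Qed.

Lemma dotZl a u v : dot (a *: u) v = a * dot u v.
Proof. by rewrite /dot mulr_sumr; apply: eq_bigr => i _; rewrite mxE mulrA. Qed.

Lemma dotNl u v : dot (- u) v = - dot u v.
Proof. by rewrite -scaleN1r dotZl mulN1r. Qed.

Lemma dotDr u v w : dot w (u + v) = dot w u + dot w v.
Proof. by rewrite dotC dotDl !(dotC w). Qed.

Lemma dotZr a u v : dot v (a *: u) = a * dot v u.
Proof. by rewrite dotC dotZl dotC. Qed.

Lemma dotNr u v : dot v (- u) = - dot v u.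
Proof. by rewrite dotC dotNl dotC. Qed.

Lemma dot0l u : dot 0 u = 0.
Proof. by rewrite -(scale0r 0) dotZl mul0r. Qed.

Definition dotE := (dotDl, dotDr, dotNl, dotNr, dotZl, dotZr).

Lemma dot_ge0 u : 0 <= dot u u.
Proof. by apply: sumr_ge0 => i _; rewrite -expr2 sqr_ge0. Qed.

Lemma dot_eq0 u : dot u u = 0 -> u = 0.
Proof.
move=> u0; apply/matrixP => i j; rewrite mxE ord1; apply/eqP.
rewrite -sqrf_eq0 expr2; apply/eqP/le_anti; rewrite -expr2 sqr_ge0 andbT.
rewrite -u0 /dot (bigD1 i)//= expr2 lerDl.
by apply: sumr_ge0 => k _; rewrite -expr2 sqr_ge0.
Qed.

Lemma dot_delta u (i : 'I_n) : dot u (delta_mx i 0) = u i 0.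
Proof.
rewrite /dot (bigD1 i)//= big1 => [|k ki]; first by rewrite mxE !eqxx mulr1 addr0.
by rewrite mxE (negPf ki) mulr0.
Qed.

Lemma enorm_ge0 u : 0 <= enorm u.
Proof. exact: sqrtr_ge0. Qed.

Lemma enorm_sqr u : enorm u ^+ 2 = dot u u.
Proof. by rewrite sqr_sqrtr// dot_ge0. Qed.

Lemma enorm0 : enorm (0 : 'cV[R]_n) = 0.
Proof. by rewrite /enorm dot0l sqrtr0. Qed.

Lemma enorm_eq0 u : enorm u = 0 -> u = 0.
Proof. by move=> u0; apply: dot_eq0; rewrite -enorm_sqr u0 expr0n. Qed.

Lemma enormZ a u : enorm (a *: u) = `|a| * enorm u.
Proof. by rewrite /enorm !dotE mulrA -expr2 sqrtrM ?sqr_ge0// sqrtr_sqr. Qed.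

Lemma enormN u : enorm (- u) = enorm u.
Proof. by rewrite -scaleN1r enormZ normrN1 mul1r. Qed.

Lemma enormB u v : enorm (u - v) = enorm (v - u).
Proof. by rewrite -enormN opprB. Qed.

Lemma cauchy_schwarz u v : dot u v <= enorm u * enorm v.
Proof.
have [->|u0] := eqVneq u 0; first by rewrite dot0l enorm0 mul0r.
have [->|v0] := eqVneq v 0; first by rewrite dotC dot0l enorm0 mulr0.
have eu : 0 < enorm u.
  by rewrite lt_neqAle enorm_ge0 andbT eq_sym; apply: contra_neq u0 => /enorm_eq0.
have ev : 0 < enorm v.
  by rewrite lt_neqAle enorm_ge0 andbT eq_sym; apply: contra_neq v0 => /enorm_eq0.
have := dot_ge0 (enorm v *: u - enorm u *: v).
rewrite !dotE (dotC v u) -!enorm_sqr !expr2.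
by move=> h; rewrite -(ler_pM2l (mulr_gt0 eu ev)); lra.
Qed.

Lemma cauchy_schwarz_norm u v : `|dot u v| <= enorm u * enorm v.
Proof.
rewrite ler_norml cauchy_schwarz andbT -lerN2 opprK -dotNl -(enormN u).
exact: cauchy_schwarz.
Qed.

Lemma enormD u v : enorm (u + v) <= enorm u + enorm v.
Proof.
rewrite -(@ler_pXn2r _ 2)// ?nnegrE ?addr_ge0 ?enorm_ge0//.
rewrite enorm_sqr !dotE (dotC v u) sqrrD !enorm_sqr.
have := cauchy_schwarz u v; lra.
Qed.

Lemma enorm_triangle v u w : enorm (u - w) <= enorm (u - v) + enorm (v - w).
Proof. by rewrite -[u - w](subrKA v) enormD. Qed.

Lemma enorm_coord u i : `|u i 0| <= enorm u.
Proof.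
rewrite -(@ler_pXn2r _ 2)// ?nnegrE ?enorm_ge0// enorm_sqr real_normK ?num_real//.
rewrite /dot (bigD1 i)//= expr2 lerDl.
by apply: sumr_ge0 => k _; rewrite -expr2 sqr_ge0.
Qed.

Lemma norm_le_enorm u : `|u| <= enorm u.
Proof.
have [u0|u0] := eqVneq (mx_norm u) 0.
  by rewrite [X in X <= _](_ : _ = 0) ?enorm_ge0.
have [[i j]] := mx_norm_neq0 u0.
by rewrite ord1 => e; rewrite [X in X <= _](_ : _ = `|u i 0|) ?enorm_coord.
Qed.

Lemma coord_le_norm u i : `|u i 0| <= `|u|.
Proof.
rewrite [X in _ <= X]mx_normrE.
exact: (le_bigmax _ (fun ij : 'I_n * 'I_1 => `|u ij.1 ij.2|) (i, 0)).
Qed.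

Lemma enorm_le_norm u : enorm u <= n%:R * `|u|.
Proof.
rewrite -(@ler_pXn2r _ 2)// ?nnegrE ?enorm_ge0 ?mulr_ge0//.
rewrite enorm_sqr exprMn -natrX.
apply: (@le_trans _ _ (n%:R * `|u| ^+ 2)).
  rewrite -[n in n%:R * _]card_ord -sum1_card natr_sum mulr_suml.
  apply: ler_sum => i _; rewrite mul1r -expr2 -(real_normK (num_real (u i 0))).
  by rewrite ler_pXn2r ?nnegrE// coord_le_norm.
by rewrite ler_wpM2r ?sqr_ge0// ler_nat -mulnn; case: (n) => // k; rewrite leq_pmulr.
Qed.

Lemma enorm_cvg_dist (u : nat -> 'cV[R]_n) v :
  u @ \oo --> v -> (fun k => enorm (u k - v)) @ \oo --> 0.
Proof.
move=> /cvgrPdist_le uv; apply/cvgrPdist_le => e e0.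
have e1 : 0 < e / n.+1%:R by rewrite divr_gt0.
near=> k; rewrite sub0r normrN ger0_norm ?enorm_ge0//.
apply: le_trans (enorm_le_norm _) _.
apply: (@le_trans _ _ (n.+1%:R * `|u k - v|)).
  by rewrite ler_wpM2r// ler_nat.
rewrite mulrC -ler_pdivlMr// distrC.
by near: k; exact: uv.
Unshelve. all: by end_near. Qed.
End Vectors.

Lemma cvg_enorm_dist n (u : nat -> 'cV[R]_n) v :
  (fun k => enorm (u k - v)) @ \oo --> 0 -> u @ \oo --> v.
Proof.
move=> /cvgrPdist_le uv; apply/cvgrPdist_le => e e0.
near=> k; rewrite distrC (le_trans (norm_le_enorm _))//.
rewrite -[enorm _]ger0_norm ?enorm_ge0// -normrN -sub0r.
by near: k; exact: uv.
Unshelve. all: by end_near. Qed.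

Lemma dot_mulmx m n (A : 'M[R]_(m, n)) u v : dot u (A *m v) = dot (A^T *m u) v.
Proof.
have dotM k (a b : 'cV[R]_k) : dot a b = (a^T *m b) 0 0.
  by rewrite mxE; apply: eq_bigr => i _; rewrite mxE.
by rewrite !dotM trmx_mul trmxK mulmxA.
Qed.

(** The Frobenius norm, used as a bound for the operator norm that depends
    continuously on the entries. *)
Definition fronorm m n (A : 'M[R]_(m, n)) : R :=
  Num.sqrt (\sum_i \sum_j A i j ^+ 2).

Lemma fronorm_ge0 m n (A : 'M[R]_(m, n)) : 0 <= fronorm A.
Proof. exact: sqrtr_ge0. Qed.

Lemma enorm_mulmx m n (A : 'M[R]_(m, n)) v : enorm (A *m v) <= fronorm A * enorm v.
Proof.
have S0 : 0 <= \sum_i \sum_j A i j ^+ 2.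
  by do 2![apply: sumr_ge0 => ? _]; exact: sqr_ge0.
rewrite -(@ler_pXn2r _ 2)// ?nnegrE ?mulr_ge0 ?fronorm_ge0 ?enorm_ge0//.
rewrite exprMn !enorm_sqr sqr_sqrtr// mulr_suml; apply: ler_sum => i _.
have -> : (A *m v) i 0 = dot (row i A)^T v.
  by rewrite mxE; apply: eq_bigr => j _; rewrite !mxE.
have -> : \sum_j A i j ^+ 2 = dot (row i A)^T (row i A)^T.
  by apply: eq_bigr => j _; rewrite !mxE expr2.
rewrite -!enorm_sqr -expr2 -exprMn -(real_normK (num_real (dot _ _))).
by rewrite ler_pXn2r ?nnegrE ?mulr_ge0 ?enorm_ge0// cauchy_schwarz_norm.
Qed.

Lemma cvg_sumr (I : Type) (r : seq I) (F : I -> nat -> R) (l : I -> R) :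
  (forall i, F i @ \oo --> l i) ->
  (fun k => \sum_(i <- r) F i k) @ \oo --> \sum_(i <- r) l i.
Proof.
move=> Fl; elim: r => [|i r IH].
  by under eq_fun do rewrite big_nil; rewrite big_nil; exact: cvg_cst.
by under eq_fun do rewrite big_cons; rewrite big_cons; exact: cvgD.
Qed.

Lemma fronorm_cvg0 m n (A : nat -> 'M[R]_(m, n)) :
  (forall i j, (fun k => A k i j) @ \oo --> 0) ->
  (fun k => fronorm (A k)) @ \oo --> 0.
Proof.
move=> A0; have S0 : (fun k => \sum_i \sum_j A k i j ^+ 2) @ \oo -->
    \sum_(i < m) \sum_(j < n) (0 : R) ^+ 2.
  apply: cvg_sumr => i; apply: (@cvg_sumr _ _ (fun j k => A k i j ^+ 2)) => j.
  by under eq_fun do rewrite expr2; rewrite expr2; apply: cvgM.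
move: S0; rewrite big1 => [S0|i _]; last by rewrite big1// => j _; rewrite expr0n.
rewrite -(@sqrtr0 R).
by apply: cvg_comp S0 _; exact: sqrt_continuous.
Qed.

Lemma enorm_col_mx n m (u : 'cV[R]_n) (v : 'cV[R]_m) :
  enorm (col_mx u v) ^+ 2 = enorm u ^+ 2 + enorm v ^+ 2.
Proof.
rewrite !enorm_sqr /dot big_split_ord/=.
by congr (_ + _); apply: eq_bigr => i _; rewrite ?col_mxEu ?col_mxEd.
Qed.

Lemma enorm_usubmx n m (w : 'cV[R]_(n + m)) : enorm (usubmx w) <= enorm w.
Proof.
rewrite -(@ler_pXn2r _ 2)// ?nnegrE ?enorm_ge0// -[w in leRHS]vsubmxK.
by rewrite enorm_col_mx lerDl sqr_ge0.
Qed.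

Lemma enorm_dsubmx n m (w : 'cV[R]_(n + m)) : enorm (dsubmx w) <= enorm w.
Proof.
rewrite -(@ler_pXn2r _ 2)// ?nnegrE ?enorm_ge0// -[w in leRHS]vsubmxK.
by rewrite enorm_col_mx lerDr sqr_ge0.
Qed.

Lemma enorm_col_mx_le n m (u : 'cV[R]_n) (v : 'cV[R]_m) :
  enorm (col_mx u v) <= enorm u + enorm v.
Proof.
rewrite -(@ler_pXn2r _ 2)// ?nnegrE ?addr_ge0 ?enorm_ge0//.
have := enorm_ge0 u; have := enorm_ge0 v; rewrite enorm_col_mx; nra.
Qed.
End EuclideanSpace.

(** * The proximal operator and the Moreau envelope *)

Section Proximal.
Context {R : realType} {m : nat}.
Variables (g : 'cV[R]_m -> \bar R) (mu : R) (z0 s0 : 'cV[R]_m).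
Hypotheses (g_proper : proper_fun g) (g_closed : closed_fun g).
Hypotheses (g_convex : convex_fun g) (mu_gt0 : 0 < mu).
Hypothesis s0_sub : subdiff g z0 s0.

Let gr (z : 'cV[R]_m) : R := fine (g z).
Let D := [set z | g z != +oo%E].

Let gE z : D z -> g z = (gr z)%:E.
Proof.
move=> /= Dz; rewrite /gr fineK// fin_numE Dz andbT; exact: g_proper.1.
Qed.

Let Dz0 : D z0.
Proof.
have [z Dz] := g_proper.2; apply/eqP => gz0.
have := s0_sub z; rewrite gz0 addye// leye_eq => /eqP gz.
by rewrite gz eqxx in Dz.
Qed.

Let minorant z : D z -> gr z0 + dot s0 (z - z0) <= gr z.
Proof. by move=> Dz; have := s0_sub z; rewrite (gE Dz0) (gE Dz) -EFinD lee_fin. Qed.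

Let convD x y t : 0 < t < 1 -> D x -> D y ->
  D (t *: x + (1 - t) *: y) /\
  gr (t *: x + (1 - t) *: y) <= t * gr x + (1 - t) * gr y.
Proof.
move=> t01 Dx Dy; have := g_convex x y t01.
rewrite (gE Dx) (gE Dy) -!EFinM -EFinD => h.
have Dxy : D (t *: x + (1 - t) *: y).
  by apply/eqP => gxy; rewrite gxy leye_eq in h.
by split=> //; rewrite -lee_fin -gE.
Qed.

Let phi (v z : 'cV[R]_m) : R := gr z + (2 * mu)^-1 * enorm (z - v) ^+ 2.

Let prox_objE v z : D z -> prox_obj mu g v z = (phi v z)%:E.
Proof. by move=> Dz; rewrite /prox_obj gE. Qed.

Let imu2_gt0 : 0 < (2 * mu)^-1. Proof. by rewrite invr_gt0 mulr_gt0. Qed.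

Let phi_lb v z : D z ->
  gr z0 + dot s0 (v - z0) - (mu / 2) * dot s0 s0 <= phi v z.
Proof.
move=> Dz; have := minorant Dz; rewrite /phi enorm_sqr.
have -> : z - z0 = (z - v) + (v - z0) by rewrite subrKA.
move: (z - v) (v - z0) => a b.
have : 0 <= (2 * mu)^-1 * dot (a + mu *: s0) (a + mu *: s0).
  by rewrite mulr_ge0 ?dot_ge0// ltW.
rewrite !dotE (dotC a s0).
have -> : forall x y w : R, (2 * mu)^-1 * (x + mu * y + (mu * y + mu * (mu * w))) =
    (2 * mu)^-1 * x + y + mu / 2 * w.
  by move=> x y w; field; rewrite gt_eqF.
lra.
Qed.

Let phi_mid v x y : D x -> D y -> D (2^-1 *: (x + y)) /\
  phi v (2^-1 *: (x + y)) <=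
    (phi v x + phi v y) / 2 - (8 * mu)^-1 * enorm (x - y) ^+ 2.
Proof.
move=> Dx Dy; have h : 0 < (2^-1 : R) < 1 by lra.
have [] := convD h Dx Dy.
have -> : 1 - 2^-1 = 2^-1 :> R by field.
rewrite -scalerDr => Dxy gxy; split=> //; rewrite /phi !enorm_sqr.
have -> : 2^-1 *: (x + y) - v = 2^-1 *: ((x - v) + (y - v)).
  by apply/matrixP => i j; rewrite !mxE; field.
have -> : x - y = (x - v) - (y - v) by apply/matrixP => i j; rewrite !mxE; ring.
move: (x - v) (y - v) => a b.
rewrite !dotE (dotC b a).
have -> : (8 * mu)^-1 = (2 * mu)^-1 / 4 by field; rewrite gt_eqF.
lra.
Qed.

Let minimizer v z := forall z', (prox_obj mu g v z <= prox_obj mu g v z')%E.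

(** The proximal objective is bounded below, thanks to the affine minorant given
    by the subgradient s0, and strongly convex, so that [phi_mid] makes every
    minimizing sequence Cauchy.  Its limit is a minimizer because the epigraph
    of g is closed. *)
Let exists_minimizer v : exists p, minimizer v p.
Proof.
pose E := [set phi v z | z in D].
have E0 : E !=set0 by exists (phi v z0), z0.
have lbE : has_lbound E.
  by exists (gr z0 + dot s0 (v - z0) - (mu / 2) * dot s0 s0) => _ [z Dz <-]; exact: phi_lb.
have infE z : D z -> inf E <= phi v z by move=> Dz; apply: ge_inf => //; exists z.
have /choice[z zP] : forall k : nat, exists z, D z /\ phi v z < inf E + k.+1%:R^-1.
  move=> k; have k0 : 0 < k.+1%:R^-1 :> R by rewrite invr_gt0.
  by have [_ [z Dz <-] zk] := inf_adherent k0 (conj E0 lbE); exists z.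
have zC k l : enorm (z k - z l) ^+ 2 <= 4 * mu * (k.+1%:R^-1 + l.+1%:R^-1).
  have [Dk pk] := zP k; have [Dl pl] := zP l; have [Dm pm] := phi_mid v Dk Dl.
  have := infE _ Dm => im.
  have m8 : 0 < 8 * mu by rewrite mulr_gt0.
  have : (8 * mu)^-1 * enorm (z k - z l) ^+ 2 <= (k.+1%:R^-1 + l.+1%:R^-1) / 2.
    have aux (x y i a b q : R) : x < i + a -> y < i + b -> i <= (x + y) / 2 - q ->
      q <= (a + b) / 2 by lra.
    exact: aux pk pl (le_trans im pm).
  rewrite -(ler_pM2l m8) mulrA divff ?gt_eqF// mul1r.
  by move: (k.+1%:R^-1) (l.+1%:R^-1) => a b; lra.
have zcvg : cvg (z @ \oo).
  apply: cauchy_cvg; apply: cauchy_exP => e e0.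
  have e2 : 0 < e ^+ 2 / (8 * mu) by rewrite divr_gt0 ?exprn_gt0 ?mulr_gt0.
  have [k k1] := ltr_add_invr e2; rewrite add0r in k1.
  exists (z k).
  suff : \forall l \near \oo, ball (z k) e (z l) by [].
  near=> l; rewrite -ball_normE/=.
  apply: le_lt_trans (norm_le_enorm _) _.
  rewrite -(@ltr_pXn2r _ 2)// ?nnegrE ?enorm_ge0 ?(ltW e0)//.
  apply: le_lt_trans (zC _ _) _.
  have l1 : l.+1%:R^-1 < e ^+ 2 / (8 * mu).
    by near: l; exact: near_infty_natSinv_lt (PosNum e2).
  have -> : e ^+ 2 = 4 * mu * (e ^+ 2 / (8 * mu) + e ^+ 2 / (8 * mu)).
    by field; rewrite gt_eqF.
  by rewrite ltr_pM2l ?mulr_gt0// ltrD.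
have {zcvg}[p zp] : exists p : 'cV[R]_m, z @ \oo --> p by exists (lim (z @ \oo)).
have ep := enorm_cvg_dist zp.
have cp : (fun k => enorm (z k - v) ^+ 2) @ \oo --> enorm (p - v) ^+ 2.
  rewrite expr2; under eq_fun do rewrite expr2.
  have h : (fun k => enorm (z k - v)) @ \oo --> enorm (p - v).
    apply/cvgrPdist_le => e e0; near=> k.
    apply: (@le_trans _ _ (enorm (z k - p))).
      have := enorm_triangle (z k) p v; have := enorm_triangle p (z k) v.
      rewrite ler_norml (enormB p (z k)); lra.
    near: k; move/cvgrPdist_le: ep => /(_ e e0); apply: filterS => k.
    by rewrite sub0r normrN; exact: le_trans (ler_norm _).
  exact: cvgM.
pose c k := inf E + k.+1%:R^-1 - (2 * mu)^-1 * enorm (z k - v) ^+ 2.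
pose c0 := inf E - (2 * mu)^-1 * enorm (p - v) ^+ 2.
have cc : c @ \oo --> c0.
  apply: cvgB; last by apply: cvgM => //; exact: cvg_cst.
  rewrite -[X in _ --> X]addr0; apply: cvgD; first exact: cvg_cst.
  exact: cvg_harmonic.
have gp : (g p <= c0%:E)%E.
  apply: (closed_cvg _ g_closed _ (p, c0) (cvg_pair zp cc)).
  near=> k => /=; have [Dz /ltW pz] := zP k.
  by rewrite gE// lee_fin /c lerBrDr.
have Dp : D p by apply/eqP => gp'; rewrite gp' leye_eq in gp.
exists p => z'; have [Dz'|nDz'] := pselect (D z'); last first.
  move/negP: nDz'; rewrite negbK => /eqP nz'.
  by rewrite {2}/prox_obj nz' addye// leey.
rewrite !prox_objE// lee_fin; apply: le_trans (infE _ Dz').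
by move: gp; rewrite gE// lee_fin /c0 /phi; lra.
Unshelve. all: by end_near. Qed.

Lemma prox_minimizer v z : (prox_obj mu g v (prox mu g v) <= prox_obj mu g v z)%E.
Proof. by move: z; exact: getPex (exists_minimizer v). Qed.

Let D_prox v : D (prox mu g v).
Proof.
have := prox_minimizer v z0; rewrite (prox_objE _ Dz0) => h.
by apply/eqP => gp; move: h; rewrite /prox_obj gp addye// leye_eq.
Qed.

Let prox_min v z : D z -> phi v (prox mu g v) <= phi v z.
Proof. by move=> Dz; rewrite -lee_fin -!prox_objE//; apply: prox_minimizer. Qed.

(** The optimality condition (v - p) / mu \in subdiff g p for p := prox v: the
    objective does not decrease from p towards z, and the quadratic term is of
    second order in the step. *)
Let prox_variational v z : D z ->
  gr (prox mu g v) + mu^-1 * dot (v - prox mu g v) (z - prox mu g v) <= gr z.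
Proof.
move=> Dz; have Dp := D_prox v; set p := prox mu g v in Dp *.
pose B := (2 * mu)^-1 * dot (z - p) (z - p).
have B0 : 0 <= B by rewrite mulr_ge0 ?dot_ge0// ltW.
have step t : 0 < t < 1 ->
    0 <= gr z - gr p - mu^-1 * dot (v - p) (z - p) + t * B.
  move=> t01; have [Dt gt] := convD t01 Dz Dp.
  have := prox_min v Dt; rewrite -/p /phi !enorm_sqr.
  have -> : t *: z + (1 - t) *: p - v = - (v - p) + t *: (z - p).
    by apply/matrixP => i j; rewrite !mxE; ring.
  have -> : p - v = - (v - p) by rewrite opprB.
  rewrite /B; have [t0 t1] := andP t01.
  have -> : mu^-1 = 2 * (2 * mu)^-1 by field; rewrite gt_eqF.
  move: (v - p) (z - p) => a b; rewrite !dotE (dotC b a) => h.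
  rewrite -(pmulr_rge0 _ t0); lra.
rewrite -subr_ge0 -[leRHS]opprK oppr_ge0.
apply/ler_addgt0Pr => e e0; rewrite add0r.
pose t := Num.min 2^-1 (e / (B + 1)).
have eB : 0 < e / (B + 1) by rewrite divr_gt0//; lra.
have t0 : 0 < t by rewrite lt_min eB andbT; lra.
have t1 : t <= 2^-1 by rewrite ge_min lexx.
have te : t * (B + 1) <= e by rewrite -ler_pdivlMr ?ge_min ?lexx ?orbT//; lra.
have : 0 < t < 1 by lra.
move=> /step; lra.
Qed.

(** Monotonicity of subdiff g, read through the optimality condition. *)
Lemma prox_firmly_nonexpansive v v' :
  dot (prox mu g v - prox mu g v') (prox mu g v - prox mu g v') <=
  dot (prox mu g v - prox mu g v') (v - v').
Proof.
move: (prox_variational v (D_prox v')) (prox_variational v' (D_prox v)).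
move: (gr (prox mu g v)) (gr (prox mu g v')) => a a'.
move: (prox mu g v) (prox mu g v') => p p' h h'.
have : mu^-1 * (dot (v - p) (p' - p) + dot (v' - p') (p - p')) <= 0 by lra.
rewrite pmulr_rle0 ?invr_gt0// !dotE.
rewrite (dotC v p) (dotC v p') (dotC v' p) (dotC v' p') (dotC p' p); lra.
Qed.

Lemma prox_subdiff : prox mu g (z0 + mu *: s0) = z0.
Proof.
have := prox_variational (z0 + mu *: s0) Dz0.
have := minorant (D_prox (z0 + mu *: s0)); set p := prox _ _ _ => h1 h2.
suff /dot_eq0/eqP : dot (z0 - p) (z0 - p) = 0 by rewrite subr_eq0 => /eqP.
apply/le_anti; rewrite dot_ge0 andbT.
have i0 : 0 < mu^-1 by rewrite invr_gt0.
rewrite -(pmulr_rle0 _ i0); move: h2.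
have -> : z0 + mu *: s0 - p = (z0 - p) + mu *: s0 by rewrite addrAC.
rewrite dotDl dotZl mulrDr mulrA mulVf ?gt_eqF// mul1r.
move: h1; rewrite -(opprB z0 p) dotNr; lra.
Qed.

Let moreauE v : moreau mu g v = phi v (prox mu g v).
Proof.
rewrite /moreau; set i := ereal_inf _.
suff -> : i = (phi v (prox mu g v))%:E by [].
rewrite -prox_objE//; apply/le_anti/andP; split.
  by apply: ereal_inf_lbound; exists (prox mu g v).
by apply: le_ereal_inf_tmp => _ [z _ <-]; exact: prox_minimizer.
Qed.

(** The minimizer at v is a competitor at v', and conversely; firm
    nonexpansiveness makes the two resulting bounds differ by a quadratic term
    only.  In particular the envelope is differentiable. *)
Lemma moreau_quadratic_bound v v' :
  `|moreau mu g v' - moreau mu g v - dot (mu^-1 *: (v - prox mu g v)) (v' - v)|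
    <= (2 * mu)^-1 * dot (v' - v) (v' - v).
Proof.
have phiE u y : phi u y = gr y + (2 * mu)^-1 * dot (y - u) (y - u).
  by rewrite /phi enorm_sqr.
have := prox_firmly_nonexpansive v' v.
have := prox_min v' (D_prox v); have := prox_min v (D_prox v').
rewrite (moreauE v) (moreauE v') (phiE v (prox mu g v)) (phiE v (prox mu g v')).
rewrite (phiE v' (prox mu g v)) (phiE v' (prox mu g v')).
move: (gr (prox mu g v)) (gr (prox mu g v')) => b b'.
move: (prox mu g v) (prox mu g v') => p p'.
have -> : mu^-1 = 2 * (2 * mu)^-1 by field; rewrite gt_eqF.
move: imu2_gt0; move: (2 * mu)^-1 => k k0.
rewrite ler_norml.
have -> : p - v' = - ((v - p) + (v' - v)) by apply/matrixP => i j; rewrite !mxE; ring.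
have -> : p' - v = (p' - v') + (v' - v) by apply/matrixP => i j; rewrite !mxE; ring.
have -> : p - v = - (v - p) by rewrite opprB.
have -> : p' - v' = (p' - p) - (v - p) - (v' - v) by apply/matrixP => i j; rewrite !mxE; ring.
move: (v - p) (v' - v) (p' - p) => a d q.
have := dot_ge0 (d - q); rewrite !dotE.
rewrite (dotC d a) (dotC q a) (dotC d q).
move=> dq h2 h1 h3.
have : 0 <= k * (dot q d - dot q q) by rewrite mulr_ge0 ?subr_ge0// ltW.
have : 0 <= k * (dot d d - 2 * dot q d + dot q q) by rewrite mulr_ge0 ?(ltW k0)//; lra.
move=> h4 h5; apply/andP; split; lra.
Qed.
End Proximal.

(** * Gradients and Hessians *)

Section Gradients.
Context {R : realType}.

Lemma diff_sum_delta n (V : normedModType R) (F : 'cV[R]_n -> V) x v :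
  differentiable F x ->
  'd F x v = \sum_j v j 0 *: 'D_(delta_mx j 0) F x.
Proof.
move=> dF; rewrite {1}(matrix_sum_delta v) linear_sum; apply: eq_bigr => j _.
by rewrite big_ord1 linearZ/= deriveE.
Qed.

Lemma derive_grad n (f : 'cV[R]_n -> R) x v :
  differentiable f x -> 'D_v f x = dot (grad f x) v.
Proof.
move=> df; rewrite deriveE// diff_sum_delta//; apply: eq_bigr => j _.
by rewrite mxE mulrC.
Qed.

Lemma diff_grad n (f : 'cV[R]_n -> R) x v :
  differentiable (grad f) x -> 'd (grad f) x v = hess f x *m v.
Proof.
move=> df; rewrite diff_sum_delta//; apply/matrixP => i k; rewrite ord1.
rewrite summxE mxE; apply: eq_bigr => j _.
by rewrite derive_mx; [rewrite !mxE mulrC|exact: diff_derivable].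
Qed.

(** The Taylor expansion of the gradient, in the Euclidean norm. *)
Lemma hess_first_order n (f : 'cV[R]_n -> R) x e :
  differentiable (grad f) x -> 0 < e ->
  \forall y \near x, enorm (grad f y - grad f x - hess f x *m (y - x)) <= e * enorm (y - x).
Proof.
move=> df e0; have e1 : 0 < e / n.+1%:R by rewrite divr_gt0.
have [_ /eqaddoP/(_ _ e1)] := (diff_locallyP _ _).1 df.
rewrite (near_shift 0 x); apply: filterS => y /=; rewrite subr0 addrK => H.
apply: le_trans (enorm_le_norm _) _.
apply: (@le_trans _ _ (n.+1%:R * `|grad f (y + x) - grad f x - hess f x *m y|)).
  by rewrite ler_wpM2r// ler_nat.
rewrite mulrC -ler_pdivlMr//; apply: (@le_trans _ _ (e / n.+1%:R * `|y|)).
  by move: H; rewrite -diff_grad// -addrA -opprD.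
by rewrite mulrAC ler_pM2r ?invr_gt0// ler_pM2l// norm_le_enorm.
Qed.

Lemma is_derive_quadratic (V : normedModType R) (h : V -> R) (w d : V) l C :
  (forall t, `|h (t *: d + w) - h w - t * l| <= C * t ^+ 2) -> is_derive w d h l.
Proof.
move=> hC.
suff hl : (fun t => t^-1 *: ((h \o shift w) (t *: d) - h w)) @ 0^' --> l.
  by apply: DeriveDef; [exact: cvgP hl|exact: cvg_lim hl].
apply/cvgrPdist_le => e e0.
have C1 : 0 < `|C| + 1 by rewrite ltr_pwDr.
near=> t.
have t0 : t != 0 by near: t; exact: nbhs_dnbhs_neq.
have te : `|t| <= e / (`|C| + 1).
  by near: t; apply: dnbhs0_le; rewrite divr_gt0.
rewrite /= -[X in X - _](mulKf t0) -scalerBr normrM normfV distrC.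
rewrite ler_pdivrMl ?normr_gt0//; apply: le_trans (hC t) _.
rewrite -(real_normK (num_real t)) expr2 mulrC -mulrA ler_wpM2l//.
apply: (@le_trans _ _ (`|t| * (`|C| + 1))).
  by rewrite ler_wpM2l// (le_trans (ler_norm _))// lerDl.
by rewrite -ler_pdivlMr.
Unshelve. all: by end_near. Qed.

(** The gradient of the proximal augmented Lagrangian, written with the formula
    (v - prox v) / mu for the gradient of the Moreau envelope. *)
Definition lagrangian_grad n m (f : 'cV[R]_n -> R) (g : 'cV[R]_m -> \bar R)
    (T : 'M[R]_(m, n)) (mu : R) (w : 'cV[R]_(n + m)) : 'cV[R]_(n + m) :=
  let z := prox_arg T mu w in
  let q := z - prox mu g z in
  col_mx (grad f (usubmx w) + mu^-1 *: (T^T *m q)) (q - mu *: dsubmx w).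

Lemma dot_col_mx n m (a c : 'cV[R]_n) (b d : 'cV[R]_m) :
  dot (col_mx a b) (col_mx c d) = dot a c + dot b d.
Proof.
rewrite /dot big_split_ord/=.
by congr (_ + _); apply: eq_bigr => i _; rewrite ?col_mxEu ?col_mxEd.
Qed.

Lemma usubmxZD n m t (d w : 'cV[R]_(n + m)) :
  usubmx (t *: d + w) = t *: usubmx d + usubmx w.
Proof. by apply/matrixP => i j; rewrite !mxE. Qed.

Lemma dsubmxZD n m t (d w : 'cV[R]_(n + m)) :
  dsubmx (t *: d + w) = t *: dsubmx d + dsubmx w.
Proof. by apply/matrixP => i j; rewrite !mxE. Qed.

Lemma prox_argZD n m (T : 'M[R]_(m, n)) mu t d w :
  prox_arg T mu (t *: d + w) = t *: prox_arg T mu d + prox_arg T mu w.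
Proof.
rewrite /prox_arg usubmxZD dsubmxZD mulmxDr -scalemxAr !scalerDr.
by rewrite addrACA !scalerA (mulrC mu).
Qed.

Lemma grad_prox_aug_lagrangian n m (f : 'cV[R]_n -> R) (g : 'cV[R]_m -> \bar R)
    (T : 'M[R]_(m, n)) mu z0 s0 w :
  (forall x, differentiable f x) ->
  proper_fun g -> closed_fun g -> convex_fun g -> 0 < mu -> subdiff g z0 s0 ->
  grad (prox_aug_lagrangian f g T mu) w = lagrangian_grad f g T mu w.
Proof.
move=> df gp gcl gcv mu0 s0g.
suff H d : is_derive w d (prox_aug_lagrangian f g T mu)
    (dot (lagrangian_grad f g T mu w) d).
  apply/matrixP => i j; rewrite ord1 mxE -dot_delta.
  by have [_ ->] := H (delta_mx i 0).
pose x := usubmx w; pose y := dsubmx w; pose z := prox_arg T mu w.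
pose dx := usubmx d; pose dy := dsubmx d; pose dz := prox_arg T mu d.
have H1 : is_derive w d (fun w => f (usubmx w)) (dot (grad f x) dx).
  have [h1 h2] : is_derive x dx f (dot (grad f x) dx).
    apply: DeriveDef; first exact: diff_derivable.
    exact: derive_grad.
  have E : (fun t : R => t^-1 *: (((fun w => f (usubmx w)) \o shift w) (t *: d) - f (usubmx w))) =
           (fun t : R => t^-1 *: ((f \o shift x) (t *: dx) - f x)).
    by apply/funext => t /=; rewrite usubmxZD.
  by apply: DeriveDef; rewrite /derivable /derive E.
have H2 : is_derive w d (fun w => moreau mu g (prox_arg T mu w))
    (dot (mu^-1 *: (z - prox mu g z)) dz).
  apply: (@is_derive_quadratic _ _ _ _ _ ((2 * mu)^-1 * dot dz dz)) => t.
  have := moreau_quadratic_bound gp gcl gcv mu0 s0g z (t *: dz + z).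
  rewrite addrK prox_argZD -/z -/dz !dotZr !dotZl.
  by have -> : forall a b : R, a * (t * (t * b)) = a * b * t ^+ 2 by move=> *; ring.
have H3 : is_derive w d (fun w => mu / 2 * enorm (dsubmx w) ^+ 2) (mu * dot y dy).
  apply: (@is_derive_quadratic _ _ _ _ _ (mu / 2 * dot dy dy)) => t.
  rewrite dsubmxZD !enorm_sqr !dotE -/y -/dy (dotC dy y).
  rewrite [X in `|X|](_ : _ = mu / 2 * dot dy dy * t ^+ 2); last by field.
  by rewrite ger0_norm// mulr_ge0 ?sqr_ge0// mulr_ge0 ?dot_ge0// divr_ge0// ltW.
rewrite (_ : dot (lagrangian_grad f g T mu w) d =
    dot (grad f x) dx + dot (mu^-1 *: (z - prox mu g z)) dz - mu * dot y dy).
  exact: is_deriveB (is_deriveD H1 H2) H3.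
rewrite /lagrangian_grad -[X in dot _ X]vsubmxK dot_col_mx -/x -/y -/z -/dx -/dy /dz.
move: (z - prox mu g z) => q; rewrite /prox_arg -/dx -/dy.
rewrite !(dotDl, dotDr, dotZl, dotZr, dotNl) dot_mulmx.
by field; rewrite gt_eqF.
Qed.
End Gradients.

(** * Strong convexity and the linearized primal-dual system *)

Section StrongConvexity.
Context {R : realType} {n : nat}.

(** The convexity inequality on the segment from y to d + y, divided by the
    parameter t, in the limit t -> 0. *)
Lemma strongly_convex_grad_le c (f : 'cV[R]_n -> R) y d :
  strongly_convex c f -> differentiable f y ->
  dot (grad f y) d + c / 2 * dot d d <= f (d + y) - f y.
Proof.
move=> fc df.
have slope t : 0 < t -> t < 1 ->
    t^-1 *: (f (t *: d + y) - f y) <= f (d + y) - f y - c / 2 * (1 - t) * dot d d.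
  move=> t0 t1; have := fc (Itv01 (ltW t0) (ltW t1)) (d + y) y (mem_set I) (mem_set I).
  rewrite convRE /= /unstable.onem.
  have -> : conv (Itv01 (ltW t0) (ltW t1)) (d + y : convex_lmodType _) y = t *: d + y.
    by apply/matrixP => i j; rewrite /conv/= /unstable.onem !mxE; ring.
  rewrite !enorm_sqr !dotE (dotC y d) => h.
  rewrite -[_ *: _]/(_ * _) ler_pdivrMl//; lra.
rewrite -lerBrDr -derive_grad//.
have hd : (fun t => t^-1 *: (f (t *: d + y) - f y)) @ 0^'+ --> 'D_d f y.
  exact: cvg_dnbhs_at_right (@diff_derivable _ _ _ f y d df).
have rhs : (fun t : R => f (d + y) - f y - c / 2 * (1 - t) * dot d d) @ 0^'+ -->
    f (d + y) - f y - c / 2 * (1 - 0) * dot d d.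
  apply: cvgB; first exact: cvg_cst.
  apply: cvgM; last exact: cvg_cst.
  apply: cvgM; first exact: cvg_cst.
  apply: cvgB; first exact: cvg_cst.
  by apply: cvg_at_right_filter; exact: cvg_id.
have -> : c / 2 * dot d d = c / 2 * (1 - 0) * dot d d by rewrite subr0 mulr1.
apply: (ler_cvg_to hd rhs).
near=> t; apply: slope; near: t; [exact: nbhs_right_gt|exact: nbhs_right_lt].
Unshelve. all: by end_near. Qed.

Lemma strongly_convex_monotone c (f : 'cV[R]_n -> R) x y :
  (forall x, differentiable f x) -> strongly_convex c f ->
  c * dot (x - y) (x - y) <= dot (grad f x - grad f y) (x - y).
Proof.
move=> df fc; have := strongly_convex_grad_le (x - y) fc (df y).
have := strongly_convex_grad_le (y - x) fc (df x).
rewrite !subrK -(opprB x y) !dotNr !dotNl !opprK; move: (x - y) => d.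
rewrite dotDl dotNl; lra.
Qed.
End StrongConvexity.

Section SaddleSystem.
Context {R : realType} {n m : nat}.
Variables (T : 'M[R]_(m, n)) (mu : R).
Hypothesis mu_gt0 : 0 < mu.
Implicit Types (h dx : 'cV[R]_n) (p dy : 'cV[R]_m).

(** The image of an increment (dx, dy) under the primal-dual map, when h and p
    are the corresponding increments of the gradient of f and of the proximal
    operator. *)
Definition saddle h p dx dy : 'cV[R]_(n + m) :=
  let q := T *m dx + mu *: dy - p in
  col_mx (h + mu^-1 *: (T^T *m q)) (q - mu *: dy).

(** The difference of the two sides is mu^-1 (dot q p + |q - mu dy|^2), where q is
    T dx + mu dy - p, and the hypothesis on p says that dot q p >= 0. *)
Lemma saddle_coercive h p dx dy :
  dot p p <= dot p (T *m dx + mu *: dy) ->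
  dot h dx <= dot (usubmx (saddle h p dx dy)) dx - dot (dsubmx (saddle h p dx dy)) dy.
Proof.
rewrite /saddle; set q := _ - p; rewrite col_mxKu col_mxKd => pq.
have TE : T *m dx = p + q - mu *: dy.
  by rewrite /q; apply/matrixP => i j; rewrite !mxE; ring.
have {pq} : 0 <= mu^-1 * dot q p.
  rewrite mulr_ge0 ?invr_ge0 ?(ltW mu_gt0)// dotC /q.
  by rewrite dotDr dotNr subr_ge0.
have : 0 <= mu^-1 * dot (q - mu *: dy) (q - mu *: dy).
  by rewrite mulr_ge0 ?dot_ge0// invr_ge0 ltW.
rewrite dotDl (dotZl mu^-1) -dot_mulmx TE; move: q TE => q _.
rewrite !dotE (dotC dy q).
move=> A B; rewrite -subr_ge0; apply: le_trans (addr_ge0 A B) _.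
by rewrite le_eqVlt; apply/orP; left; apply/eqP; field; rewrite gt_eqF.
Qed.

(** A Lipschitz constant of the primal-dual map with respect to |dx| + |dy|, when
    L is one of grad f. *)
Definition saddle_const L : R :=
  L + (mu^-1 * fronorm T^T + 1) * (fronorm T + mu) + mu.

Lemma saddle_const_ge0 L : 0 <= L -> 0 <= saddle_const L.
Proof.
move=> L0; have m0 := ltW mu_gt0.
by rewrite !addr_ge0 ?mulr_ge0 ?addr_ge0 ?mulr_ge0 ?fronorm_ge0 ?invr_ge0.
Qed.

Lemma saddle_bounded h p dx dy L :
  0 <= L -> enorm h <= L * enorm dx -> dot p p <= dot p (T *m dx + mu *: dy) ->
  enorm (saddle h p dx dy) <= saddle_const L * (enorm dx + enorm dy).
Proof.
move=> L0 hL pq; rewrite /saddle_const; set C := fronorm T + mu; rewrite /saddle; set q := _ - p.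
have tau0 := fronorm_ge0 T; have tau0' := fronorm_ge0 T^T.
have x0 := enorm_ge0 dx; have y0 := enorm_ge0 dy.
have sC : enorm (T *m dx + mu *: dy) <= C * (enorm dx + enorm dy).
  apply: le_trans (enormD _ _) _; rewrite enormZ gtr0_norm//.
  have := enorm_mulmx T dx; rewrite /C.
  have : 0 <= mu * enorm dx by rewrite mulr_ge0 ?(ltW mu_gt0).
  have : 0 <= fronorm T * enorm dy by rewrite mulr_ge0.
  lra.
have qs : enorm q <= C * (enorm dx + enorm dy).
  apply: le_trans sC; rewrite -(@ler_pXn2r _ 2)// ?nnegrE ?enorm_ge0//.
  rewrite !enorm_sqr /q; move: pq; move: (T *m dx + _) => s pq.
  by rewrite !dotE (dotC s p); have := dot_ge0 p; lra.
have i0 : 0 <= mu^-1 by rewrite invr_ge0 ltW.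
apply: le_trans (enorm_col_mx_le _ _) _.
have h1 : enorm (h + mu^-1 *: (T^T *m q)) <=
    L * enorm dx + mu^-1 * (fronorm T^T * enorm q).
  apply: le_trans (enormD _ _) _; rewrite enormZ (ger0_norm i0) lerD//.
  by rewrite ler_wpM2l// enorm_mulmx.
have h2 : enorm (q - mu *: dy) <= enorm q + mu * enorm dy.
  by apply: le_trans (enormD _ _) _; rewrite enormN enormZ gtr0_norm.
have h3 : (mu^-1 * fronorm T^T + 1) * enorm q <=
    (mu^-1 * fronorm T^T + 1) * (C * (enorm dx + enorm dy)).
  by rewrite ler_wpM2l// addr_ge0// mulr_ge0.
have h4 : 0 <= L * enorm dy by rewrite mulr_ge0.
have h5 : 0 <= mu * enorm dx by rewrite mulr_ge0 ?(ltW mu_gt0).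
lra.
Qed.

(** Full row rank gives T a right inverse, whose transpose is a left inverse of
    the transpose of T. *)
Lemma enorm_trmx_mul_ge dy : row_free T ->
  enorm dy <= fronorm (pinvmx T)^T * enorm (T^T *m dy).
Proof.
move=> Tfree; rewrite -[X in enorm X <= _]mul1mx -trmx1 -(mulmxVp Tfree) trmx_mul.
by rewrite -mulmxA enorm_mulmx.
Qed.

(** The inverse of the primal-dual map is Lipschitz: the monotonicity of h
    controls dx, after which full row rank of T controls dy. *)
Lemma saddle_bounded_below c L : row_free T -> 0 < c -> 0 <= L ->
  exists2 C : R, 0 < C & forall h p dx dy,
    c * dot dx dx <= dot h dx -> enorm h <= L * enorm dx ->
    dot p p <= dot p (T *m dx + mu *: dy) ->
    enorm (col_mx dx dy) <= C * enorm (saddle h p dx dy).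
Proof.
move=> Tfree c0 L0.
pose K := fronorm (pinvmx T)^T; pose C1 := K * (1 + mu^-1 * fronorm T^T).
pose C2 := K * L.
(* With X := |dx| and Y the norm of the image, the two bounds combine into
   c X ^ 2 <= (1 + C2) Y X + C1 Y ^ 2, which forces X <= (D + 1) Y. *)
pose D := (1 + C2) / c + C1 / c.
have K0 : 0 <= K := fronorm_ge0 _.
have i0 : 0 <= mu^-1 by rewrite invr_ge0 ltW.
have C10 : 0 <= C1 by rewrite mulr_ge0// addr_ge0// mulr_ge0 ?fronorm_ge0.
have C20 : 0 <= C2 by rewrite mulr_ge0.
have D0 : 0 <= D by rewrite addr_ge0// divr_ge0 ?addr_ge0// ltW.
have D1 : 0 <= D + 1 by rewrite ler_wpDr.
exists (D + 1 + C1 + C2 * (D + 1)).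
  by have := mulr_ge0 C20 D1; lra.
move=> h p dx dy hc hL pq; have core := saddle_coercive h pq.
set F := saddle h p dx dy in core *.
have F0 := enorm_ge0 F; have x0 := enorm_ge0 dx; have y0 := enorm_ge0 dy.
have aF : enorm (usubmx F) <= enorm F := enorm_usubmx F.
have bF : enorm (dsubmx F) <= enorm F := enorm_dsubmx F.
have Ty : T^T *m dy = usubmx F - h - mu^-1 *: (T^T *m dsubmx F).
  rewrite /F /saddle col_mxKu col_mxKd; move: (_ - p) => q.
  rewrite mulmxBr -scalemxAr scalerBr scalerA mulVf ?gt_eqF// scale1r.
  by apply/matrixP => i j; rewrite !mxE; ring.
have yB : enorm dy <= C1 * enorm F + C2 * enorm dx.
  apply: le_trans (enorm_trmx_mul_ge dy Tfree) _; rewrite -/K Ty.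
  have -> : C1 * enorm F + C2 * enorm dx =
    K * (enorm F + L * enorm dx + mu^-1 * (fronorm T^T * enorm F)).
    by rewrite /C1 /C2; ring.
  rewrite ler_wpM2l//; apply: le_trans (enormD _ _) _; apply: lerD.
    apply: le_trans (enormD _ _) _; rewrite enormN; exact: lerD.
  rewrite enormN enormZ (ger0_norm i0) ler_wpM2l//.
  apply: le_trans (enorm_mulmx _ _) _; by rewrite ler_wpM2l ?fronorm_ge0.
have xB : enorm dx <= (D + 1) * enorm F.
  rewrite leNgt; apply/negP => lt.
  have h1 : dot (usubmx F) dx <= enorm F * enorm dx.
    by apply: le_trans (cauchy_schwarz _ _) _; rewrite ler_wpM2r.
  have h2 : - dot (dsubmx F) dy <= enorm F * enorm dy.
    rewrite -dotNl; apply: le_trans (cauchy_schwarz _ _) _.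
    by rewrite enormN ler_wpM2r.
  have h3 : c * enorm dx ^+ 2 <= enorm F * enorm dx + enorm F * enorm dy.
    by rewrite enorm_sqr; lra.
  have h4 : enorm F * enorm dy <= enorm F * (C1 * enorm F + C2 * enorm dx).
    by rewrite ler_wpM2l.
  have Fx : enorm F <= enorm dx.
    by apply: ltW; apply: le_lt_trans lt; rewrite mulrDl mul1r lerDr mulr_ge0.
  have x1 : 0 < enorm dx by apply: le_lt_trans lt; rewrite mulr_ge0.
  have h5 : C1 * (enorm F * enorm F) <= C1 * (enorm F * enorm dx).
    by rewrite ler_wpM2l// ler_wpM2l.
  have h6 : c * enorm dx ^+ 2 <= c * (D * enorm F * enorm dx).
    have -> : c * (D * enorm F * enorm dx) = (1 + C2 + C1) * (enorm F * enorm dx).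
      by rewrite /D; field; rewrite gt_eqF.
    lra.
  have h7 : enorm dx <= D * enorm F.
    by move: h6; rewrite ler_pM2l// expr2 ler_pM2r.
  lra.
apply: le_trans (enorm_col_mx_le _ _) _.
have : C2 * enorm dx <= C2 * ((D + 1) * enorm F) by rewrite ler_wpM2l.
lra.
Qed.

(** The right-hand side minus the left-hand side is the sum of the two
    nonnegative numbers dot (v - P v) (P (v - P v)) and dot (P v) ((1 - P) (P v)). *)
Lemma possemidef_firmly_nonexpansive (P : 'M[R]_m) v :
  possemidef P -> possemidef (1%:M - P) -> dot (P *m v) (P *m v) <= dot (P *m v) v.
Proof.
move=> [Psym P0] [_ Q0]; have := P0 (v - P *m v); have := Q0 (P *m v).
have sym u w : dot (P *m u) w = dot u (P *m w) by rewrite dot_mulmx Psym.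
rewrite mulmxBl mul1mx mulmxBr; move: (sym v (P *m v)).
move: (P *m v) sym => u sym uv.
rewrite !dotDl !dotDr !dotNl !dotNr (dotC v u); lra.
Qed.

(** A generalized Hessian acts as the primal-dual map with increments that are
    linear in (dx, dy); all estimates on [saddle] thus apply to it. *)
Lemma newton_matrixE (H : 'M[R]_n) (P : 'M[R]_m) dx dy :
  newton_matrix T mu H P *m col_mx dx dy =
  saddle (H *m dx) (P *m (T *m dx + mu *: dy)) dx dy.
Proof.
rewrite /newton_matrix /saddle mul_block_col.
have -> u : u - P *m u = (1%:M - P) *m u by rewrite mulmxBl mul1mx.
set Q := 1%:M - P.
have i : mu^-1 * mu = 1 by rewrite mulVf// gt_eqF.
congr col_mx.
- rewrite mulmxDl -scalemxAl -addrA; congr (_ + _).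
  move: Q => Q.
  by rewrite !mulmxDr !scalerDr -!scalemxAr scalerA i scale1r !mulmxA.
- rewrite [Q *m (_ + _)]mulmxDr -mulmxA -addrA; congr (_ + _).
  by rewrite mulNmx -scalemxAl /Q mulmxBl mul1mx -scalemxAr addrAC subrr add0r.
Qed.

Lemma newton_matrix_unit (H : 'M[R]_n) (P : 'M[R]_m) :
  row_free T -> posdef H -> possemidef P -> possemidef (1%:M - P) ->
  newton_matrix T mu H P \in unitmx.
Proof.
move=> Tfree [_ H0] P0 Q0; rewrite -unitmx_tr -row_free_unit.
apply: inj_row_free => v /(congr1 trmx); rewrite trmx_mul trmxK trmx0.
rewrite -[v]trmxK; move: (v^T) => {v} w; rewrite trmxK -[w]vsubmxK.
move: (usubmx w) (dsubmx w) => dx dy {w}; rewrite newton_matrixE => s0.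
have := saddle_coercive (H *m dx) (possemidef_firmly_nonexpansive (T *m dx + mu *: dy) P0 Q0).
rewrite s0 !linear0 !dot0l subr0 => h.
have dx0 : dx = 0.
  by apply/eqP/negPn/negP => /H0; rewrite dotC ltNge => /negP; apply.
move: s0; rewrite dx0 /saddle; set q := _ - _ => s0.
have /(congr1 (@dsubmx _ _ _ _)) := s0; rewrite col_mxKd linear0 => /subr0_eq qE.
have /(congr1 (@usubmx _ _ _ _)) := s0; rewrite col_mxKu !linear0 add0r qE.
rewrite -scalemxAr scalerA mulVf ?gt_eqF// scale1r => Ty0.
have := enorm_trmx_mul_ge dy Tfree; rewrite Ty0 enorm0 mulr0 => y0.
rewrite (@enorm_eq0 _ _ dy) ?col_mx0 ?trmx0//.
by apply/le_anti; rewrite y0 enorm_ge0.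
Qed.
End SaddleSystem.

Section SaddleIncrements.
Context {R : realType} {n m : nat}.
Variables (T : 'M[R]_(m, n)) (mu : R).

Lemma saddleB (h h' : 'cV[R]_n) (p p' : 'cV[R]_m) dx dx' dy dy' :
  saddle T mu h p dx dy - saddle T mu h' p' dx' dy' =
  saddle T mu (h - h') (p - p') (dx - dx') (dy - dy').
Proof.
rewrite /saddle.
have -> : T *m (dx - dx') + mu *: (dy - dy') - (p - p') =
    (T *m dx + mu *: dy - p) - (T *m dx' + mu *: dy' - p').
  rewrite mulmxBr scalerBr; move: (T *m dx) (T *m dx') => a b.
  by apply/matrixP => i j; rewrite !mxE; ring.
move: (_ - p) (_ - p') => q q'.
rewrite opp_col_mx add_col_mx mulmxBr scalerBr scalerBr; congr col_mx.
  by rewrite opprD addrACA.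
by apply/matrixP => i j; rewrite !mxE; ring.
Qed.

Lemma saddle_residual (h : 'cV[R]_n) (p : 'cV[R]_m) :
  0 < mu ->
  enorm (saddle T mu h p 0 0) <= enorm h + (mu^-1 * fronorm T^T + 1) * enorm p.
Proof.
move=> mu0; have i0 : 0 <= mu^-1 by rewrite invr_ge0 ltW.
rewrite /saddle mulmx0 scaler0 addr0 sub0r subr0.
apply: le_trans (enorm_col_mx_le _ _) _; rewrite enormN mulrDl mul1r addrA lerD2r.
apply: le_trans (enormD _ _) _; rewrite lerD2l enormZ (ger0_norm i0) -mulrA.
by rewrite ler_wpM2l// -[enorm p]enormN enorm_mulmx.
Qed.

Lemma prox_argB (w w' : 'cV[R]_(n + m)) :
  prox_arg T mu w - prox_arg T mu w' = prox_arg T mu (w - w').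
Proof. by rewrite [w - w']addrC -(scaleN1r w') prox_argZD scaleN1r addrC. Qed.

Lemma enorm_prox_arg (w : 'cV[R]_(n + m)) : 0 < mu ->
  enorm (prox_arg T mu w) <= (fronorm T + mu) * enorm w.
Proof.
move=> mu0; apply: le_trans (enormD _ _) _; rewrite mulrDl; apply: lerD.
  apply: le_trans (enorm_mulmx _ _) _.
  by rewrite ler_wpM2l ?fronorm_ge0// enorm_usubmx.
by rewrite enormZ gtr0_norm// ler_wpM2l ?enorm_dsubmx// ltW.
Qed.
End SaddleIncrements.

(** * Absolutely continuous functions and slopes along sequences *)

Section RealLine.
Context {R : realType}.

Lemma norm_lt_coord n (u : 'cV[R]_n) e :
  0 < e -> (forall i, `|u i 0| < e) -> `|u| < e.
Proof.
move=> e0 ue; have [u0|/mx_norm_neq0[[i j]]] := eqVneq (mx_norm u) 0.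
  by rewrite [X in X < _](_ : _ = 0).
by rewrite ord1 => u0; rewrite [X in X < _](_ : _ = `|u i 0|).
Qed.

(** If t is not such a limit, then for some rational q > t and some k no s in
    G between t and q has v s within 1 / (k + 1) of v t, coordinatewise.  The
    numbers q, k and the floors of (k + 1) v t then determine t: if s > t had
    the same code, s would lie between t and q with v s too close to v t. *)
Lemma countable_not_right_limit n (G : set R) (v : R -> 'cV[R]_n) :
  countable [set t | G t /\
    ~ forall e, 0 < e -> exists s, [/\ t < s, s < t + e, G s & `|v s - v t| < e]].
Proof.
set B := [set t | _].
have codeP t : exists c : rat * nat * 'cV[int]_n, B t ->
    [/\ t < ratr c.1.1, forall i, c.2 i 0 = Num.floor (c.1.2.+1%:R * v t i 0) &
     forall s, t < s -> s < ratr c.1.1 -> G s ->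
       ~ (forall i, `|v s i 0 - v t i 0| < c.1.2.+1%:R^-1) ].
  have [[Gt]|nB] := pselect (B t); last by exists (0, 0%N, 0).
  move=> /existsNP[e] /not_implyP[e0] nlim.
  have [q] : exists q : rat, ratr q \in `]t, t + e[ by apply: rat_in_itvoo; lra.
  rewrite in_itv/= => /andP[tq qe].
  have [k ke] : exists k : nat, k.+1%:R^-1 < e.
    have [k] := ltr_add_invr e0; rewrite add0r; by exists k.
  exists (q, k, \col_i Num.floor (k.+1%:R * v t i 0)) => _; split => //=.
    by move=> i; rewrite mxE.
  move=> s ts sq Gs vst; apply: nlim; exists s; split => //.
    exact: lt_trans sq qe.
  by apply: norm_lt_coord => // i; rewrite !mxE; apply: lt_trans ke.
have [code codeE] := choice codeP.
apply/countable_injP; exists (pickle \o code) => t s /set_mem Bt /set_mem Bs.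
move=> /= /(pcan_inj pickleK) cts.
have distinct a b : B a -> B b -> code a = code b -> ~ a < b.
  move=> Ba Bb cab ab; have [_ fa far] := codeE _ Ba.
  have [bq fb _] := codeE _ Bb; rewrite -cab in bq fb.
  have [Gb _] := Bb.
  apply: (far b) => // i; set k := (code a).1.2.+1%:R.
  have k0 : 0 < k :> R by rewrite ltr0n.
  have := floor_itv (k * v a i 0); rewrite -fa.
  have := floor_itv (k * v b i 0); rewrite -fb => /andP[b1 b2] /andP[a1 a2].
  rewrite intrD in a2 b2.
  rewrite -(ltr_pM2l k0) divff ?gt_eqF// -{1}(gtr0_norm k0) -normrM mulrBr.
  by rewrite ltr_norml; lra.
have [ts|st|//] := ltgtP t s; first by have := distinct _ _ Bt Bs cts ts.
by have := distinct _ _ Bs Bt (esym cts) st.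
Qed.

(** The scalar form of [absolutely_continuous_on], with the absolute value in
    place of the Euclidean norm of a vector with one entry. *)
Definition ac_on (a b : R) (phi : R -> R) : Prop :=
  forall e, 0 < e -> exists2 d, 0 < d &
    forall k (l r : 'I_k -> R),
      (forall i, a <= l i <= r i /\ r i <= b) ->
      trivIset setT (fun i => `]l i, r i[%classic) ->
      \sum_i (r i - l i) < d -> \sum_i `|phi (r i) - phi (l i)| < e.

Lemma ac_on_continuous a b phi e : ac_on a b phi -> 0 < e ->
  exists2 d, 0 < d & forall l r, a <= l <= r -> r <= b -> r - l < d ->
    `|phi r - phi l| < e.
Proof.
move=> /(_ e)+ e0 => /(_ e0)[d d0 H]; exists d => // l r lr rb rld.
have := H 1%N (fun=> l) (fun=> r); rewrite !big_ord1; apply => //.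
by apply/trivIsetP => i j _ _; rewrite !ord1 eqxx.
Qed.

Lemma sum_itv_le_measure (U : set R) k (l r : 'I_k -> R) :
  measurable U -> (forall i, l i <= r i /\ `]l i, r i[ `<=` U) ->
  trivIset setT (fun i => `]l i, r i[%classic) ->
  ((\sum_i (r i - l i))%:E <= lebesgue_measure U)%E.
Proof.
move=> mU lrU tlr.
have mI i : measurable (`]l i, r i[%classic : set R) by [].
have -> : (\sum_i (r i - l i))%:E =
    (lebesgue_measure (\big[setU/set0]_(i < k) `]l i, r i[%classic))%E.
  rewrite measure_bigsetU_ord// -sumEFin; apply: eq_bigr => i _.
  apply/esym; apply: etrans (lebesgue_measure_itv `]l i, r i[) _.
  rewrite /= lte_fin EFinB; case: ltP => // rl.
  have /eqP -> : r i == l i by rewrite eq_le rl (lrU i).1.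
  by rewrite subee.
apply: le_measure; rewrite ?inE//; first exact: bigsetU_measurable.
elim/big_ind: _ => [//|P Q PU QU x [/PU|/QU]//|i _].
exact: (lrU i).2.
Qed.

(** Let U be an open set of small measure containing N.  From a point
    outside N, some step to the right makes phi grow by at most e times its
    length; from a point of N, a short step stays inside U and its growth is
    absorbed by V t, the supremum of the oscillations of phi over disjoint
    intervals of U below t, which absolute continuity makes small.  The bound
    phi t <= phi 0 + e t + V t survives left limits, because phi is continuous
    and V is nondecreasing, and it can be pushed beyond any t < b; hence it
    holds up to b. *)
Lemma ac_on_nonincreasing (b : R) (phi : R -> R) (N : set R) :
  0 <= b -> ac_on 0 b phi -> (@lebesgue_measure R).-negligible N ->
  (forall t, 0 <= t < b -> ~ N t -> forall e, 0 < e ->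
    exists2 s, t < s < t + e & phi s - phi t <= e * (s - t)) ->
  phi b <= phi 0.
Proof.
move=> b0 acphi [A [mA A0 NA]] slope; apply/ler_addgt0Pr => e0 e0_gt0.
pose e := e0 / (b + 2).
have b2 : 0 < b + 2 by lra.
have e_gt0 : 0 < e by rewrite divr_gt0.
have eE : e * b + e + e = e0 by rewrite /e; field; rewrite gt_eqF.
have [d d0 acd] := acphi _ e_gt0.
have [U [oU AU mUA]] : exists U : set R,
    [/\ open U, A `<=` U & (lebesgue_measure (U `\` A) < d%:E)%E].
  by apply: lebesgue_regularity_outer => //; rewrite [X in (X < _)%E]A0 ltry.
have mU : measurable U by exact: measurable_realfun.open_measurable.
have mUd : (lebesgue_measure U < d%:E)%E.
  rewrite -(setDUK AU); apply: le_lt_trans mUA.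
  rewrite -[leRHS]add0e -A0; apply: measureU2 => //.
  exact: measurableD.
pose fam t : set R := [set x | exists k (l r : 'I_k -> R),
  [/\ forall i, 0 <= l i <= r i /\ r i <= t, forall i, `]l i, r i[ `<=` U,
      trivIset setT (fun i => `]l i, r i[%classic) &
      x = \sum_i `|phi (r i) - phi (l i)| ] ].
have fam0 t : fam t 0.
  exists 0%N, (fun=> 0), (fun=> 0); split => //; try by case.
  by rewrite big_ord0.
have fam_le t x : t <= b -> fam t x -> x <= e.
  move=> tb [k [l [r [lr lrU tlr ->]]]]; apply/ltW/acd => //.
    by move=> i; have [? ?] := lr i; split => //; apply: le_trans tb.
  rewrite -lte_fin; apply: le_lt_trans mUd; apply: sum_itv_le_measure => // i.
  by have [/andP[]] := lr i.
have fam_mono t s x : t <= s -> fam t x -> fam s x.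
  move=> ts [k [l [r [lr lrU tlr ->]]]]; exists k, l, r; split => // i.
  by have [? ?] := lr i; split => //; apply: le_trans ts.
have fam_ext t s x : 0 <= t -> t <= s -> `]t, s[ `<=` U -> fam t x ->
    fam s (x + `|phi s - phi t|).
  move=> t0 ts tsU [k [l [r [lr lrU tlr ->]]]].
  pose l' (i : 'I_k.+1) := oapp l t (unlift ord_max i).
  pose r' (i : 'I_k.+1) := oapp r s (unlift ord_max i).
  exists k.+1, l', r'; split.
  - move=> i; rewrite /l' /r'; case: unliftP => [j _|_]/=; last by rewrite t0 ts.
    by have [? ?] := lr j; split => //; apply: le_trans ts.
  - by move=> i; rewrite /l' /r'; case: unliftP => [j _|_] /=; [exact: lrU|exact: tsU].
  - apply/trivIsetP => i j _ _; rewrite /l' /r'.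
    have sep p : `]l p, r p[ `&` `]t, s[ = set0 :> set R.
      apply/seteqP; split => // y [] /=; rewrite !in_itv/= => /andP[_ yr] /andP[ty _].
      have [_ rt] := lr p; lra.
    case: unliftP => [p|] ->; case: unliftP => [q|] -> /=.
    + move/trivIsetP: tlr => /(_ p q) tlr pq; apply: tlr => //.
      by apply: contra_neq pq => ->.
    + by rewrite sep.
    + by rewrite setIC sep.
    + by rewrite eqxx.
  - rewrite (bigD1_ord ord_max)//= addrC /l' /r' unlift_none/=.
    by congr (_ + _); apply: eq_bigr => i _; rewrite liftK.
pose V t := sup (fam t).
have fam_ub t : t <= b -> has_ubound (fam t).
  by move=> tb; exists e => x; apply: fam_le.
have V_mono t s : t <= s -> s <= b -> V t <= V s.
  move=> ts sb; apply: ge_sup; first by exists 0.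
  by move=> x /(fam_mono _ _ _ ts); apply: ub_le_sup; apply: fam_ub.
have V_ext t s : 0 <= t -> t <= s -> s <= b -> `]t, s[ `<=` U ->
    V t + `|phi s - phi t| <= V s.
  move=> t0 ts sb tsU; rewrite -lerBrDr; apply: ge_sup; first by exists 0.
  move=> x /(fam_ext _ _ _ t0 ts tsU); rewrite lerBrDr.
  by apply: ub_le_sup; apply: fam_ub.
pose S := [set t | 0 <= t <= b /\ phi t <= phi 0 + e * t + V t].
have S0 : S 0.
  split; first by rewrite lexx b0.
  have : 0 <= V 0 by apply: ub_le_sup => //; apply: fam_ub.
  lra.
have supS : has_sup S.
  by split; [exists 0|exists b => t [/andP[]]].
set T := sup S.
have T0 : 0 <= T by apply: ub_le_sup => //; case: supS.
have Tb : T <= b by apply: ge_sup; [exists 0|move=> t [/andP[]]].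
have ST : S T.
  split; first by rewrite T0 Tb.
  apply/ler_addgt0Pr => eta eta0.
  have [c c0 cphi] := ac_on_continuous acphi eta0.
  have [t [/andP[t0 tb] tS] tT] := sup_adherent c0 supS.
  have tleT : t <= T by apply: ub_le_sup; [case: supS|split => //; rewrite t0 tb].
  have := cphi t T; rewrite t0 tleT Tb => /(_ isT isT).
  rewrite -/T in tT; have /[swap]/[apply] : T - t < c by lra.
  have := V_mono _ _ tleT Tb; have : e * t <= e * T by rewrite ler_pM2l.
  have := ler_norm (phi T - phi t); lra.
have -> : b = T.
  apply/eqP; rewrite eq_le Tb andbT leNgt; apply/negP => Tltb.
  have [_ phiT] := ST.
  have noS s : T < s -> s <= b -> ~ phi s <= phi 0 + e * s + V s.
    move=> Ts sb Ss; have : S s by split => //; apply/andP; split; lra.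
    by move/(ub_le_sup supS.2); rewrite -/T; lra.
  have [NT|NT] := pselect (N T).
    have /nbhs_ballP[c/= c0 cU] : nbhs T U by apply: open_nbhs_nbhs; split; auto.
    pose s := Num.min b (T + c / 2).
    have Ts : T < s by rewrite lt_min Tltb/=; lra.
    have sb : s <= b by rewrite ge_min lexx.
    have sc : s <= T + c / 2 by rewrite ge_min lexx orbT.
    apply: (noS s) => //.
    have : V T + `|phi s - phi T| <= V s.
      apply: V_ext => //; first exact: ltW.
      move=> y /=; rewrite in_itv/= => /andP[Ty ys]; apply: cU.
      by rewrite /ball/= ltr_norml; apply/andP; split; lra.
    have := ler_norm (phi s - phi T).
    have : e * T <= e * s by rewrite ler_pM2l// ltW.
    lra.
  pose c := Num.min e (b - T).
  have c0 : 0 < c by rewrite lt_min e_gt0/=; lra.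
  have ce : c <= e by rewrite ge_min lexx.
  have cb : c <= b - T by rewrite ge_min lexx orbT.
  have [|s /andP[Ts sT] slopes] := slope T _ NT _ c0; first by rewrite T0.
  have sb : s <= b by lra.
  apply: (noS s) => //; have := V_mono _ _ (ltW Ts) sb.
  have : c * (s - T) <= e * (s - T) by rewrite ler_pM2r// subr_gt0.
  lra.
have [_ ] := ST.
have : V T <= e by apply: ge_sup; [exists 0|move=> x; apply: fam_le].
have : e * T <= e * b by rewrite ler_pM2l.
lra.
Qed.
End RealLine.

Section ExponentialDecay.
Context {R : realType}.
Implicit Types (phi psi : R -> R) (b : R).

(** Cut [0, b] into steps on which phi varies by less than 1. *)
Lemma ac_on_bounded b phi : ac_on 0 b phi ->
  exists2 M, 0 < M & forall t, 0 <= t <= b -> `|phi t| <= M.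
Proof.
move=> acphi; have [d d0 dphi] := ac_on_continuous acphi ltr01.
have step k t : 0 <= t <= b -> t <= k%:R * (d / 2) -> `|phi t - phi 0| <= k%:R.
  elim: k t => [|k IH] t /andP[t0 tb].
    by rewrite mul0r => t1; rewrite (@le_anti _ _ t 0) ?t0 ?t1// subrr normr0.
  have [tk _|kt tk1] := leP t (k%:R * (d / 2)).
    by apply: le_trans (IH _ _ tk) _; rewrite ?t0 ?ler_nat.
  set t' := k%:R * (d / 2) in kt.
  have t'0 : 0 <= t' by rewrite mulr_ge0// divr_ge0// ltW.
  have t'b : 0 <= t' <= b by rewrite t'0/=; lra.
  have tt' : t - t' < d by move: tk1; rewrite -natr1 mulrDl -/t'; lra.
  have t't : 0 <= t' <= t by rewrite t'0 ltW.
  have := dphi t' t t't tb tt'; have := IH _ t'b (lexx _).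
  have := ler_normD (phi t - phi t') (phi t' - phi 0); rewrite subrKA -natr1; lra.
have d2 : 0 < d / 2 by rewrite divr_gt0.
pose k := (Num.truncn (b / (d / 2))).+1.
exists (k%:R + `|phi 0| + 1) => [|t t0b].
  by rewrite ltr_wpDl// addr_ge0.
have bk : b <= k%:R * (d / 2).
  rewrite -ler_pdivrMr//; apply: ltW; exact: truncnS_gt.
have := step k t t0b; case/andP: t0b => t0 tb /(_ (le_trans tb bk)).
by have := ler_normD (phi t - phi 0) (phi 0); rewrite subrK; lra.
Qed.

Lemma ac_on_lipschitz b phi L :
  (forall l r, 0 <= l <= r -> r <= b -> `|phi r - phi l| <= L * (r - l)) ->
  ac_on 0 b phi.
Proof.
move=> phiL e e0; have L1 : 0 < `|L| + 1 by rewrite ltr_wpDl.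
exists (e / (`|L| + 1)) => [|k l r lr _ lrd]; first by rewrite divr_gt0.
rewrite ltr_pdivlMr// in lrd; apply: le_lt_trans lrd.
rewrite mulr_suml; apply: ler_sum => i _; have [lri rb] := lr i.
apply: le_trans (phiL _ _ lri rb) _; rewrite mulrC ler_wpM2l//.
  by rewrite subr_ge0; case/andP: lri.
by rewrite (le_trans (ler_norm _))// lerDl.
Qed.

Lemma ac_onM b phi psi : ac_on 0 b phi -> ac_on 0 b psi ->
  ac_on 0 b (fun t => phi t * psi t).
Proof.
move=> acphi acpsi e e0.
have [M M0 phiM] := ac_on_bounded acphi; have [K K0 psiK] := ac_on_bounded acpsi.
have eK : 0 < e / (2 * K) by rewrite divr_gt0// mulr_gt0.
have eM : 0 < e / (2 * M) by rewrite divr_gt0// mulr_gt0.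
have [d d0 dphi] := acphi _ eK; have [c c0 cpsi] := acpsi _ eM.
exists (Num.min d c) => [|k l r lr tlr]; first by rewrite lt_min d0.
rewrite lt_min => /andP[/(dphi _ _ _ lr tlr)+ /(cpsi _ _ _ lr tlr)].
rewrite -(ltr_pM2l K0) -(ltr_pM2l M0 (\sum_i _)).
have -> : K * (e / (2 * K)) = e / 2 by field; rewrite gt_eqF.
have -> : M * (e / (2 * M)) = e / 2 by field; rewrite gt_eqF.
move=> h1 h2; have {h1 h2} := ltrD h1 h2.
have -> : e / 2 + e / 2 = e by field.
apply: le_lt_trans; rewrite !mulr_sumr -big_split/=; apply: ler_sum => i _.
have [/andP[l0 lri] rb] := lr i.
have -> : phi (r i) * psi (r i) - phi (l i) * psi (l i) =
  psi (r i) * (phi (r i) - phi (l i)) + phi (l i) * (psi (r i) - psi (l i)) by ring.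
apply: le_trans (ler_normD _ _) _; rewrite !normrM.
apply: lerD; rewrite ler_wpM2r//.
  by apply: psiK; rewrite rb (le_trans l0).
by apply: phiM; rewrite l0 (le_trans lri).
Qed.

Lemma expR_dist (l r : R) : l <= r -> expR r - expR l <= expR r * (r - l).
Proof.
move=> lr; have -> : expR l = expR r * expR (l - r) by rewrite -expRD subrKC.
rewrite -{1}[expR r]mulr1 -mulrBr ler_pM2l ?expR_gt0//.
have := expR_ge1Dx (l - r); lra.
Qed.

Lemma ac_on_expR b : ac_on 0 b (@expR R).
Proof.
apply: (@ac_on_lipschitz _ _ (expR b)) => l r /andP[l0 lr] rb.
rewrite ger0_norm ?subr_ge0 ?ler_expR//; apply: le_trans (expR_dist lr) _.
by rewrite ler_wpM2r ?subr_ge0// ler_expR.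
Qed.

Lemma expR_second_order (t h : R) : 0 <= h ->
  `|expR (t + h) - expR t - h * expR (t + h)| <= expR (t + h) * h ^+ 2.
Proof.
move=> h0; have -> : expR t = expR (t + h) * expR (- h) by rewrite -expRD addrK.
set x := expR (t + h); have x0 : 0 < x := expR_gt0 _.
have -> : x - x * expR (- h) - h * x = - (x * (expR (- h) - 1 + h)) by ring.
rewrite normrN normrM gtr0_norm// ler_pM2l//.
have e1 := expR_ge1Dx (- h); rewrite ger0_norm; last lra.
have e2 := expR_ge1Dx h.
have : (1 + h) * expR (- h) <= 1.
  by rewrite -[leRHS](@expRxMexpNx_1 _ h) ler_wpM2r ?expR_ge0.
have := expR_ge0 (- h) => e3.
move: e1 e2 e3; move: (expR (- h)) => y *; nra.
Qed.

(** The product exp t * phi t is absolutely continuous and its slope at almost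
    every t vanishes along a sequence decreasing to t, so that both it and its
    opposite are nonincreasing. *)
Lemma exponential_decay b (N : set R) phi :
  0 <= b -> ac_on 0 b phi -> (@lebesgue_measure R).-negligible N ->
  (forall t, 0 <= t < b -> ~ N t -> forall e, 0 < e ->
    exists2 s, t < s < t + e & `|phi s - phi t + (s - t) * phi t| <= e * (s - t)) ->
  phi b = expR (- b) * phi 0.
Proof.
move=> b0 acphi negN slope; pose u t := expR t * phi t.
have acu : ac_on 0 b u := ac_onM (@ac_on_expR b) acphi.
have slope_u t : 0 <= t < b -> ~ N t -> forall e, 0 < e ->
    exists2 s, t < s < t + e & `|u s - u t| <= e * (s - t).
  move=> t0b Nt e e0.
  pose A := expR (t + 1) * (1 + `|phi t|).
  have A0 : 0 < A by rewrite mulr_gt0 ?expR_gt0// ltr_pwDl.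
  pose d := Num.min 1 (Num.min e (e / A)).
  have d0 : 0 < d by rewrite !lt_min ltr01 e0 divr_gt0.
  have d1 : d <= 1 by rewrite ge_min lexx.
  have de : d <= e by rewrite !ge_min lexx orbT.
  have dA : d * A <= e by rewrite -ler_pdivlMr// !ge_min lexx !orbT.
  have [s /andP[ts sd] slopes] := slope t t0b Nt d d0.
  exists s; first by rewrite ts/=; lra.
  pose h := s - t; have h0 : 0 < h by rewrite subr_gt0.
  have sE : s = t + h by rewrite /h addrC subrK.
  have hd : h <= d by lra.
  have := expR_second_order t (ltW h0); rewrite -sE => e2.
  have -> : u s - u t = expR s * (phi s - phi t + (s - t) * phi t) +
      phi t * (expR s - expR t - h * expR s) by rewrite /u /h; ring.
  apply: le_trans (ler_normD _ _) _; rewrite !normrM (gtr0_norm (expR_gt0 s)).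
  apply: (@le_trans _ _ (expR s * (d * h) + `|phi t| * (expR s * (d * h)))).
    apply: lerD; first by rewrite ler_pM2l ?expR_gt0.
    rewrite ler_wpM2l//; apply: le_trans e2 _.
    by rewrite ler_pM2l ?expR_gt0// expr2 ler_pM2r.
  have -> : expR s * (d * h) + `|phi t| * (expR s * (d * h)) =
    (d * (expR s * (1 + `|phi t|))) * h by ring.
  rewrite -/h ler_pM2r//; apply: le_trans dA.
  by rewrite ler_pM2l// ler_pM2r ?ltr_pwDl// ler_expR; lra.
have ub : u b = u 0.
  apply/eqP; rewrite eq_le; apply/andP; split.
    apply: (ac_on_nonincreasing b0 acu negN) => t t0b Nt e e0.
    have [s ts us] := slope_u t t0b Nt e e0; exists s => //.
    exact: le_trans (ler_norm _) us.
  rewrite -lerN2; apply: (@ac_on_nonincreasing _ b (fun t => - u t) N) => //.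
    move=> e e0; have [d d0 du] := acu e e0; exists d => // k l r lr tlr lrd.
    apply: le_lt_trans (du k l r lr tlr lrd); apply: ler_sum => i _.
    by rewrite -opprD normrN.
  move=> t t0b Nt e e0; have [s ts us] := slope_u t t0b Nt e e0; exists s => //.
  by apply: le_trans (ler_norm _) _; rewrite -opprD normrN.
have : u b = phi 0 by rewrite ub /u expR0 mul1r.
by rewrite /u => <-; rewrite mulrA -expRD addNr expR0 mul1r.
Qed.
End ExponentialDecay.

(** * The generalized Newton flow *)

Section Sequences.
Context {R : realType}.

Lemma enorm_near n (u : nat -> 'cV[R]_n) (v : 'cV[R]_n) e : u @ \oo --> v -> 0 < e ->
  \forall k \near \oo, enorm (u k - v) <= e.
Proof.
move=> /enorm_cvg_dist /cvgrPdist_le uv /uv; apply: filterS => k.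
by rewrite sub0r normrN; exact: le_trans (ler_norm _).
Qed.

Lemma cvg_enorm_le n m (u : nat -> 'cV[R]_n) (a : 'cV[R]_n)
    (v : nat -> 'cV[R]_m) (b : 'cV[R]_m) C :
  (forall k, enorm (u k - a) <= C * enorm (v k - b)) -> v @ \oo --> b ->
  u @ \oo --> a.
Proof.
move=> uC /enorm_near vb; apply: cvg_enorm_dist; apply/cvgrPdist_le => e e0.
have C1 : 0 < `|C| + 1 by rewrite ltr_wpDl.
have := vb _ (divr_gt0 e0 C1); apply: filterS => k ve.
rewrite sub0r normrN ger0_norm ?enorm_ge0//; apply: le_trans (uC k) _.
apply: (@le_trans _ _ ((`|C| + 1) * enorm (v k - b))).
  by rewrite ler_wpM2r ?enorm_ge0// (le_trans (ler_norm _))// lerDl.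
by rewrite mulrC -ler_pdivlMr.
Qed.

Lemma fronorm_near m n (X : topologicalType) (A : X -> 'M[R]_(m, n))
    (x : nat -> X) xb e :
  continuous A -> x @ \oo --> xb -> 0 < e ->
  \forall k \near \oo, fronorm (A (x k) - A xb) <= e.
Proof.
move=> cA xxb e0.
have AA : (fun k => A (x k)) @ \oo --> A xb by apply: cvg_comp xxb _; exact: cA.
have /cvgrPdist_le : (fun k => fronorm (A (x k) - A xb)) @ \oo --> 0.
  apply: fronorm_cvg0 => i j; under eq_fun do rewrite !mxE.
  apply/subr_cvg0; apply: (cvg_comp _ (fun M : 'M[R]_(m, n) => M i j) AA).
  exact: coord_continuous.
move=> /(_ _ e0); apply: filterS => k.
by rewrite sub0r normrN; exact: le_trans (ler_norm _).
Qed.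

Lemma derivable_first_order n (w : R -> 'cV[R]_n) t e : derivable w t 1 -> 0 < e ->
  exists2 d, 0 < d & forall s, t < s < t + d ->
    enorm ((s - t)^-1 *: (w s - w t) - derive1 w t) <= e.
Proof.
move=> dw e0; have e1 : 0 < e / n.+1%:R by rewrite divr_gt0.
have /cvgrPdist_le/(_ _ e1) : (fun h => h^-1 *: (w (h *: 1 + t) - w t)) @ 0^' --> 'D_1 w t.
  exact: dw.
move=> /nbhs_ballP[d /= d0 dh]; exists d => // s /andP[ts sd].
have h0 : 0 < s - t by rewrite subr_gt0.
apply: le_trans (enorm_le_norm _) _.
apply: (@le_trans _ _ (n.+1%:R * `|(s - t)^-1 *: (w s - w t) - derive1 w t|)).
  by rewrite ler_wpM2r// ler_nat.
rewrite mulrC -ler_pdivlMr// distrC derive1E.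
have := dh (s - t); rewrite /= [(s - t) *: 1]mulr1 subrK; apply.
  by rewrite -ball_normE/= sub0r normrN gtr0_norm//; lra.
by rewrite gt_eqF.
Qed.
End Sequences.

Section NewtonFlow.
Context {R : realType} {n m : nat}.
Variables (f : 'cV[R]_n -> R) (g : 'cV[R]_m -> \bar R) (T : 'M[R]_(m, n)).
Variables (Lf mf mu : R) (xstar : 'cV[R]_n) (ystar : 'cV[R]_m).
Hypotheses (f_C2 : twice_continuously_differentiable f).
Hypotheses (f_lip : lipschitz_gradient Lf f).
Hypotheses (f_hess : forall x : 'cV[R]_n, posdef (hess f x)).
Hypotheses (g_proper : proper_fun g) (g_closed : closed_fun g) (g_convex : convex_fun g).
Hypotheses (T_full : row_free T) (mu_gt0 : 0 < mu).
Hypotheses (prox_semismooth : semismooth (prox mu g)).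
Hypotheses (mf_gt0 : 0 < mf) (f_strong : strongly_convex mf f).
Hypothesis (wstar_opt : optimal_pair f g T xstar ystar).

Let F := lagrangian_grad f g T mu.
Let wstar := col_mx xstar ystar.

Let gradE w : grad (prox_aug_lagrangian f g T mu) w = F w.
Proof.
have [df _ _] := f_C2; have [_ sub] := wstar_opt.
exact: grad_prox_aug_lagrangian sub.
Qed.

Let FE w : F w = saddle T mu (grad f (usubmx w)) (prox mu g (prox_arg T mu w))
  (usubmx w) (dsubmx w).
Proof. by []. Qed.

Let FB w w' : F w - F w' = saddle T mu (grad f (usubmx w) - grad f (usubmx w'))
  (prox mu g (prox_arg T mu w) - prox mu g (prox_arg T mu w'))
  (usubmx (w - w')) (dsubmx (w - w')).
Proof. by rewrite !FE saddleB !linearB. Qed.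

Let grad_lip x x' : enorm (grad f x - grad f x') <= `|Lf| * enorm (x - x').
Proof.
by apply: le_trans (f_lip x x') _; rewrite ler_wpM2r ?enorm_ge0 ?ler_norm.
Qed.

Let prox_incr w w' :
  let p := prox mu g (prox_arg T mu w) - prox mu g (prox_arg T mu w') in
  dot p p <= dot p (T *m usubmx (w - w') + mu *: dsubmx (w - w')).
Proof.
have [_ sub] := wstar_opt.
have := prox_firmly_nonexpansive g_proper g_closed g_convex mu_gt0 sub
  (prox_arg T mu w) (prox_arg T mu w').
by rewrite prox_argB.
Qed.

Let F_lipschitz : exists2 C, 0 < C & forall w w', enorm (F w - F w') <= C * enorm (w - w').
Proof.
exists (2 * saddle_const T mu `|Lf| + 1) => [|w w'].
  by rewrite ltr_wpDl// mulr_ge0// saddle_const_ge0.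
rewrite FB.
have := saddle_bounded mu_gt0 (normr_ge0 _) (_ : _ <= `|Lf| * _) (@prox_incr w w').
move=> /(_ (grad f (usubmx w) - grad f (usubmx w'))).
rewrite {1}linearB => /(_ (grad_lip _ _)) /le_trans; apply.
have := enorm_usubmx (w - w'); have := enorm_dsubmx (w - w').
have := saddle_const_ge0 T mu_gt0 (normr_ge0 Lf); have := enorm_ge0 (w - w').
move: (saddle_const _ _ _) (enorm (w - w')) (enorm (usubmx _)) (enorm (dsubmx _)).
by move=> S a b c *; nra.
Qed.

Let F_error_bound : exists2 C, 0 < C & forall w w', enorm (w - w') <= C * enorm (F w - F w').
Proof.
have [C C0 H] := saddle_bounded_below mu_gt0 T_full mf_gt0 (normr_ge0 Lf).
exists C => // w w'; rewrite FB -{1}[w - w']vsubmxK; have [df _ _] := f_C2.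
apply: H; last exact: prox_incr.
  by rewrite linearB; exact: strongly_convex_monotone.
by rewrite linearB.
Qed.

Let F_star : F wstar = 0.
Proof.
have [gradx sub] := wstar_opt.
have proxz := prox_subdiff g_proper g_closed g_convex mu_gt0 sub.
rewrite /F /lagrangian_grad /prox_arg /wstar col_mxKu col_mxKd proxz.
have -> : T *m xstar + mu *: ystar - T *m xstar = mu *: ystar by rewrite addrC addKr.
rewrite subrr -scalemxAr scalerA mulVf ?gt_eqF// scale1r.
by rewrite gradx col_mx0.
Qed.

(** Semismoothness linearizes F with the generalized Hessian taken at the moving
    points w k, not at their limit; for grad f this needs the continuity of the
    Hessian. *)
Let newton_approximation (w : nat -> 'cV[R]_(n + m)) wb (J : nat -> 'M[R]_(n + m)) :
  w @ \oo --> wb -> (forall k, gen_hessian f g T mu (w k) (J k)) ->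
  (forall e, 0 < e -> \forall k \near \oo,
     enorm (F (w k) - F wb - J k *m (w k - wb)) <= e * enorm (w k - wb)) /\
  (exists2 C, 0 < C & \forall k \near \oo, forall v, enorm (J k *m v) <= C * enorm v).
Proof.
move=> wwb HJ.
have /choice[P HP] : forall k, exists P,
    [/\ clarke_jacobian (prox mu g) (prox_arg T mu (w k)) P, possemidef P &
      possemidef (1%:M - P)] /\ newton_matrix T mu (hess f (usubmx (w k))) P = J k.
  by move=> k; have [P ? ?] := HJ k; exists P.
have [df ddf chess] := f_C2.
pose x k := usubmx (w k); pose z k := prox_arg T mu (w k).
pose H k := hess f (x k).
have JE k v : J k *m v = saddle T mu (H k *m usubmx v) (P k *m prox_arg T mu v)
    (usubmx v) (dsubmx v).
  by have [_ <-] := HP k; rewrite -{1}[v]vsubmxK newton_matrixE.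
have xx : x @ \oo --> usubmx wb.
  apply: (cvg_enorm_le (C := 1)) wwb => k; rewrite mul1r -linearB; exact: enorm_usubmx.
have zz : z @ \oo --> prox_arg T mu wb.
  by apply: (cvg_enorm_le (C := fronorm T + mu)) wwb => k; rewrite prox_argB enorm_prox_arg.
split=> [e e0|].
  (* A is the factor of |p| in [saddle_residual], B the Lipschitz constant of
     prox_arg. *)
  pose A := mu^-1 * fronorm T^T + 1; pose B := fronorm T + mu.
  have A0 : 0 < A.
    by rewrite ltr_wpDl// mulr_ge0 ?fronorm_ge0// invr_ge0 ltW.
  have B0 : 0 < B by rewrite ltr_wpDl// fronorm_ge0.
  have e4 : 0 < e / 4 by rewrite divr_gt0.
  have eAB : 0 < e / 4 / (A * B) by rewrite divr_gt0// mulr_gt0.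
  have hessx := hess_first_order (ddf (usubmx wb)) e4.
  have cJ k : clarke_jacobian (prox mu g) (z k) (P k) by have [[]] := HP k.
  have /eqoP/(_ _ eAB) semi := prox_semismooth zz cJ.
  have Hnear := fronorm_near chess xx e4.
  have near1 : \forall k \near \oo, enorm (grad f (x k) - grad f (usubmx wb) -
      hess f (usubmx wb) *m (x k - usubmx wb)) <= e / 4 * enorm (x k - usubmx wb).
    exact: xx hessx.
  near=> k; rewrite (FB (w k) wb) (JE k) saddleB.
  rewrite (subrr (usubmx (w k - wb))) (subrr (dsubmx (w k - wb))).
  apply: le_trans (saddle_residual _ _ _ mu_gt0) _; rewrite -/A.
  set d := w k - wb; have d0 := enorm_ge0 d.
  have h1 : enorm (grad f (x k) - grad f (usubmx wb) - H k *m usubmx d) <=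
      e / 2 * enorm d.
    have dE : usubmx d = x k - usubmx wb by rewrite linearB.
    have -> : grad f (x k) - grad f (usubmx wb) - H k *m usubmx d =
        (grad f (x k) - grad f (usubmx wb) - hess f (usubmx wb) *m usubmx d) +
        - ((H k - hess f (usubmx wb)) *m usubmx d).
      by rewrite mulmxBl opprB addrA subrK.
    have dd : enorm (usubmx d) <= enorm d := enorm_usubmx d.
    have hd : e / 4 * enorm (usubmx d) <= e / 4 * enorm d by rewrite ler_pM2l.
    have n1 : enorm (grad f (x k) - grad f (usubmx wb) -
        hess f (usubmx wb) *m usubmx d) <= e / 4 * enorm (usubmx d).
      by rewrite dE; near: k.
    have n2 : enorm ((H k - hess f (usubmx wb)) *m usubmx d) <= e / 4 * enorm (usubmx d).
      apply: le_trans (enorm_mulmx _ _) _; rewrite ler_wpM2r ?enorm_ge0//.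
      by near: k.
    apply: le_trans (enormD _ _) _; rewrite enormN; lra.
  have h2 : enorm (prox mu g (z k) - prox mu g (prox_arg T mu wb) - P k *m prox_arg T mu d)
      <= e / 4 / A * enorm d.
    have dE : prox_arg T mu d = z k - prox_arg T mu wb by rewrite prox_argB.
    have := enorm_prox_arg T d mu_gt0; rewrite -/B dE => zB.
    have : `|enorm (prox mu g (z k) - prox mu g (prox_arg T mu wb) +
        P k *m (prox_arg T mu wb - z k))| <=
        e / 4 / (A * B) * `|enorm (z k - prox_arg T mu wb)| by near: k.
    rewrite !ger0_norm ?enorm_ge0// -(opprB (z k)) mulmxN => /le_trans; apply.
    have -> : e / 4 / A * enorm d = e / 4 / (A * B) * (B * enorm d).
      by field; rewrite !gt_eqF.
    by rewrite ler_pM2l.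
  have : A * enorm (prox mu g (z k) - prox mu g (prox_arg T mu wb) -
      P k *m prox_arg T mu d) <= e / 4 * enorm d.
    by rewrite -ler_pdivlMl// mulrA [A^-1 * _]mulrC.
  have := mulr_ge0 (ltW e0) d0; move: h1; rewrite -/(x k) -/(z k); lra.
pose L := fronorm (hess f (usubmx wb)) + 1.
have L0 : 0 <= L by rewrite addr_ge0// fronorm_ge0.
exists (2 * saddle_const T mu L + 1).
  by rewrite ltr_wpDl// mulr_ge0// saddle_const_ge0.
have := fronorm_near chess xx ltr01; apply: filterS => k Hk v; rewrite JE.
have [[_ P0 Q0] _] := HP k.
have hL : enorm (H k *m usubmx v) <= L * enorm (usubmx v).
  have -> : H k = (H k - hess f (usubmx wb)) + hess f (usubmx wb) by rewrite subrK.
  rewrite mulmxDl /L mulrDl mul1r addrC; apply: le_trans (enormD _ _) _.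
  apply: lerD; first exact: enorm_mulmx.
  apply: le_trans (enorm_mulmx _ _) _.
  by rewrite -[leRHS]mul1r ler_wpM2r ?enorm_ge0.
have := saddle_bounded mu_gt0 L0 hL (possemidef_firmly_nonexpansive (prox_arg T mu v) P0 Q0).
move=> /le_trans; apply.
have := enorm_usubmx v; have := enorm_dsubmx v.
have := saddle_const_ge0 T mu_gt0 L0; have := enorm_ge0 v.
move: (saddle_const _ _ _) (enorm v) (enorm (usubmx _)) (enorm (dsubmx _)).
by move=> S a b c *; nra.
Unshelve. all: by end_near. Qed.

Let regular_time (w : R -> 'cV[R]_(n + m)) : set R :=
  [set t | [/\ 0 <= t, derivable w t 1 & newton_field f g T mu (w t) (derive1 w t)]].

Let newton_equation w v : newton_field f g T mu w v ->
  exists2 J, gen_hessian f g T mu w J & J *m v = - F w.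
Proof.
move=> [J JH <-]; exists J => //; rewrite gradE mulmxN mulKVmx//.
by have [P [_ P0 Q0] <-] := JH; exact: newton_matrix_unit.
Qed.

(** Write D for the difference quotient of w between t and s, and J for the
    generalized Hessian selected at time s.  Up to the semismoothness error,
    F (w s) - F (w t) is (s - t) J D, and J D is J (w' s) = - F (w s) up to
    J (D - w' s), which is small because D and w' s both tend to w' t. *)
Let newton_slope w t : regular_time w t ->
  (forall e, 0 < e -> exists s,
     [/\ t < s, s < t + e, regular_time w s & `|derive1 w s - derive1 w t| < e]) ->
  forall e, 0 < e -> exists2 s, t < s < t + e &
    enorm (F (w s) - F (w t) + (s - t) *: F (w t)) <= e * (s - t).
Proof.
move=> [t0 dwt _] right e e0; set v := derive1 w t.
have /choice[s Hs] : forall k : nat, exists s, [/\ t < s, s < t + k.+1%:R^-1, regular_time w s &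
    `|derive1 w s - v| < k.+1%:R^-1].
  by move=> k; apply: right; rewrite invr_gt0.
have near_inv (d : R) : 0 < d -> \forall k \near \oo, k.+1%:R^-1 < d.
  by move=> d0; exact: near_infty_natSinv_lt (PosNum d0).
have v_near d : 0 < d -> \forall k \near \oo, enorm (derive1 w (s k) - v) <= d.
  suff vv : (fun k => derive1 w (s k)) @ \oo --> v by move=> d0; exact: enorm_near vv d0.
  apply/cvgrPdist_lt => c c0; apply: filterS (near_inv c c0) => k kc.
  by rewrite distrC; have [_ _ _] := Hs k; move/lt_trans; apply.
have D_near d : 0 < d -> \forall k \near \oo,
    enorm ((s k - t)^-1 *: (w (s k) - w t) - v) <= d.
  move=> d0; have [c c0 Dc] := derivable_first_order dwt d0.
  apply: filterS (near_inv c c0) => k kc; apply: Dc.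
  by have [-> sk _ _] := Hs k; rewrite (lt_trans sk)// ltrD2l.
have h0 k : 0 < s k - t by have [ts _ _ _] := Hs k; rewrite subr_gt0.
have wE k : w (s k) - w t = (s k - t) *: ((s k - t)^-1 *: (w (s k) - w t)).
  by rewrite scalerA mulfV ?gt_eqF// scale1r.
have w_near d : 0 < d -> \forall k \near \oo, enorm (w (s k) - w t) <= d.
  move=> d0; have v1 : 0 < enorm v + 1 by rewrite ltr_wpDl ?enorm_ge0.
  near=> k; rewrite wE enormZ gtr0_norm//.
  have sk : s k - t <= d / (enorm v + 1).
    have : k.+1%:R^-1 < d / (enorm v + 1) by near: k; apply: near_inv; rewrite divr_gt0.
    by have [_ sk _ _] := Hs k => kd; rewrite lerBlDl ltW// (lt_trans sk)// ltrD2l.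
  have Dv : enorm ((s k - t)^-1 *: (w (s k) - w t)) <= enorm v + 1.
    have : enorm ((s k - t)^-1 *: (w (s k) - w t) - v) <= 1 by near: k; exact: D_near.
    have := enormD ((s k - t)^-1 *: (w (s k) - w t) - v) v; rewrite subrK; lra.
  apply: le_trans (ler_pM _ _ sk Dv) _; rewrite ?enorm_ge0 ?(ltW (h0 k))//.
  by rewrite divfK// gt_eqF.
have wcvg : (w \o s) @ \oo --> w t.
  apply: cvg_enorm_dist; apply/cvgrPdist_le => d d0; apply: filterS (w_near d d0) => k.
  by rewrite sub0r normrN ger0_norm ?enorm_ge0.
have /choice[J HJ] : forall k, exists J, gen_hessian f g T mu (w (s k)) J /\
    J *m derive1 w (s k) = - F (w (s k)).
  by move=> k; have [_ _ [_ _ /newton_equation[J ? ?]] _] := Hs k; exists J.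
have [approx [C C0 JC]] := newton_approximation wcvg (fun k => (HJ k).1).
have [K K0 FK] := F_lipschitz.
have v1 : 0 < enorm v + 1 by rewrite ltr_wpDl ?enorm_ge0.
(* The semismoothness error, the matrix term and the variation of F along w
   contribute at most e / 3 each. *)
pose e2 := Num.min 1 (e / 6 / C).
have e20 : 0 < e2 by rewrite lt_min ltr01 !divr_gt0.
have e21 : e2 <= 1 by rewrite ge_min lexx.
have e2C : C * e2 <= e / 6 by rewrite mulrC -ler_pdivlMr// ge_min lexx orbT.
have e10 : 0 < e / 3 / (enorm v + 1) by rewrite !divr_gt0.
have e30 : 0 < e / 3 / K by rewrite !divr_gt0.
near \oo => k; exists (s k).
  have [-> sk _ _] := Hs k; apply: lt_trans sk _; rewrite ltrD2l.
  by near: k; exact: near_inv.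
have n1 : enorm (F (w (s k)) - F (w t) - J k *m (w (s k) - w t)) <=
    e / 3 / (enorm v + 1) * enorm (w (s k) - w t) by near: k; exact: approx.
have n2 : forall u, enorm (J k *m u) <= C * enorm u by near: k.
have n3 : enorm ((s k - t)^-1 *: (w (s k) - w t) - v) <= e2 by near: k; exact: D_near.
have n4 : enorm (derive1 w (s k) - v) <= e2 by near: k; exact: v_near.
have n5 : enorm (w (s k) - w t) <= e / 3 / K by near: k; exact: w_near.
have hk := h0 k; have wk := wE k; set h := s k - t in hk wk n3 *.
set D := h^-1 *: (w (s k) - w t) in wk n3.
clearbody D h v.
have -> : F (w (s k)) - F (w t) + h *: F (w t) =
    (F (w (s k)) - F (w t) - J k *m (w (s k) - w t)) +
    h *: (J k *m (D - derive1 w (s k)) + (F (w t) - F (w (s k)))).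
  rewrite [J k *m (D - _)]mulmxBr (HJ k).2 opprK [in RHS]wk -scalemxAr.
  move: (J k *m D) (F (w (s k))) (F (w t)) => a b c.
  by apply/matrixP => p q; rewrite !mxE; ring.
have Dv : enorm D <= enorm v + 1.
  by have := enormD (D - v) v; rewrite subrK; lra.
have p1 : enorm (F (w (s k)) - F (w t) - J k *m (w (s k) - w t)) <= h * (e / 3).
  apply: le_trans n1 _; rewrite wk enormZ gtr0_norm//.
  rewrite mulrCA ler_pM2l//.
  apply: (@le_trans _ _ (e / 3 / (enorm v + 1) * (enorm v + 1))).
    by rewrite ler_pM2l.
  by rewrite divfK// gt_eqF.
have p2 : enorm (J k *m (D - derive1 w (s k))) <= e / 3.
  apply: le_trans (n2 _) _; have := enorm_triangle v D (derive1 w (s k)).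
  rewrite (enormB v (derive1 w (s k))) => tri.
  have : C * enorm (D - derive1 w (s k)) <= C * (e2 + e2) by rewrite ler_pM2l//; lra.
  lra.
have p3 : enorm (F (w t) - F (w (s k))) <= e / 3.
  apply: le_trans (FK _ _) _; rewrite enormB.
  by rewrite mulrC -ler_pdivlMr.
apply: le_trans (enormD _ _) _; rewrite enormZ gtr0_norm// [leRHS]mulrC.
have : h * enorm (J k *m (D - derive1 w (s k)) + (F (w t) - F (w (s k)))) <= h * (e / 3 + e / 3).
  by rewrite ler_pM2l//; apply: le_trans (enormD _ _) _; exact: lerD.
lra.
Unshelve. all: by end_near. Qed.

Let gradient_ac w b i : absolutely_continuous_on 0 b w ->
  ac_on 0 b (fun t => F (w t) i 0).
Proof.
have [C C0 FC] := F_lipschitz; move=> acw e e0.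
have [d d0 wd] := acw (e / C) (divr_gt0 e0 C0); exists d => // k l r lr tlr lrd.
have := wd k l r lr tlr lrd; rewrite ltr_pdivlMr// mulr_suml.
apply: le_lt_trans; apply: ler_sum => j _.
have := enorm_coord (F (w (r j)) - F (w (l j))) i; rewrite !mxE => /le_trans; apply.
by rewrite mulrC; exact: FC.
Qed.

(** Each coordinate of F o w has the slope required by [exponential_decay], except
    on the null set where the inclusion fails and at the countably many times
    that are isolated from the right in the graph of the velocity. *)
Let gradient_decay w t : is_solution (newton_field f g T mu) w -> 0 <= t ->
  F (w t) = expR (- t) *: F (w 0).
Proof.
move=> [acw aew] t0; apply/matrixP => i j; rewrite ord1 [RHS]mxE.
pose isolated := [set s | regular_time w s /\ ~ forall e, 0 < e -> exists r,
  [/\ s < r, r < s + e, regular_time w r & `|derive1 w r - derive1 w s| < e]].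
have countable_isolated : countable isolated := countable_not_right_limit _ _.
have negligible_isolated : (@lebesgue_measure R).-negligible isolated.
  exists isolated; split => //; last exact: countable_lebesgue_measure0.
  exact: countable_measurable.
have negN := negligibleU aew negligible_isolated.
apply: (@exponential_decay R t _ (fun s => F (w s) i 0) t0 (gradient_ac i (acw t)) negN).
move=> s /andP[s0 st] Ns e e0.
have gs : regular_time w s.
  have [|ngs] := pselect (0 <= s -> derivable w s 1 /\ newton_field f g T mu (w s) (derive1 w s)).
    by move=> /(_ s0)[].
  by case: Ns; left.
have [right|nright] := pselect (forall e, 0 < e -> exists r,
    [/\ s < r, r < s + e, regular_time w r & `|derive1 w r - derive1 w s| < e]); last first.
  by case: Ns; right.
have [r sr Fr] := newton_slope gs right e0; exists r => //.
apply: le_trans Fr.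
have := enorm_coord (F (w r) - F (w s) + (r - s) *: F (w s)) i.
by rewrite !mxE.
Qed.

Lemma newton_flow_exponential_bound : exists2 kappa, 0 < kappa &
  forall w, is_solution (newton_field f g T mu) w -> forall t, 0 <= t ->
    enorm (w t - wstar) <= kappa * expR (- t) * enorm (w 0 - wstar).
Proof.
have [C C0 FC] := F_lipschitz; have [K K0 FK] := F_error_bound.
exists (K * C) => [|w solw t t0]; first exact: mulr_gt0.
apply: le_trans (FK _ _) _; rewrite -[leRHS]mulrA -[leRHS]mulrA ler_pM2l//.
rewrite F_star subr0 (gradient_decay solw t0) enormZ gtr0_norm ?expR_gt0//.
rewrite mulrCA ler_pM2l ?expR_gt0//.
by have := FC (w 0) wstar; rewrite F_star subr0.
Qed.

End NewtonFlow.

Unset Implicit Arguments.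

Theorem theorem7 (R : realType) (n m : nat)
    (f : 'cV[R]_n -> R) (g : 'cV[R]_m -> \bar R) (T : 'M[R]_(m, n))
    (Lf mf mu : R)
    (f_C2 : twice_continuously_differentiable f)
    (f_lip : lipschitz_gradient Lf f)
    (f_sconv : strictly_convex f)
    (f_hess : forall x : 'cV[R]_n, posdef (hess f x))
    (g_proper : proper_fun g) (g_closed : closed_fun g) (g_convex : convex_fun g)
    (T_full : row_free T)
    (mu_gt0 : 0 < mu)
    (prox_semismooth : semismooth (prox mu g))
    (mf_gt0 : 0 < mf)
    (f_strong : strongly_convex mf f)
    (sol_exists : forall w0 : 'cV[R]_(n + m),
       exists2 w : R -> 'cV[R]_(n + m),
         is_solution (newton_field f g T mu) w & w 0 = w0)
    (xstar : 'cV[R]_n) (ystar : 'cV[R]_m)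
    (wstar_opt : optimal_pair f g T xstar ystar) :
  exists2 kappa : R, 0 < kappa &
    forall w : R -> 'cV[R]_(n + m),
      is_solution (newton_field f g T mu) w ->
      forall t : R, 0 <= t ->
        enorm (w t - col_mx xstar ystar)
          <= kappa * expR (- t) * enorm (w 0 - col_mx xstar ystar).
Proof.
exact: (newton_flow_exponential_bound f_C2 f_lip f_hess g_proper g_closed g_convex
  T_full mu_gt0 prox_semismooth mf_gt0 f_strong wstar_opt).
Qed.
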